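(* Let $b:\mathbb{R}^m\to\mathbb{R}^m$ be three times continuously differentiable, and suppose there are constants $\kappa$ and $\mu$ such that $$\langle x-y,\,b(x)-b(y)\rangle\le\kappa|x-y|^2\qquad\text{for all }x,y\in\mathbb{R}^m,$$ $$\max_{i=0,\dots,3}|\partial^i b(x)|\le\kappa(1+|x|^\mu)\qquad\text{for all }x\in\mathbb{R}^m .$$ Let $X$ satisfy $X_t=x_0+\int_0^t b(X_s)\,ds+B_t$, $t\in[0,T]$, and for a partition $\pi$ of $[0,T]$ let $Y=Y^\pi$ be the (interpolated) backward Euler approximation. There is a constant $C$, independent of the partition $\pi$ (but dependent on $\kappa,\mu,T$), such that $$\mathbb{E}\Big[\sup_{0\le t\le T}|Y_t-X_t|^2\Big]\le C|\pi|^2$$ and $$\int_0^T\mathbb{E}|Y_t-X_t|^2\,dt\le C|\pi|^2 .$$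
   Context: Fix $T>0$, an integer $m\ge1$, $x_0\in\mathbb{R}^m$ and $H_1,\dots,H_m\in(1/2,1)$. $B=(B^1,\dots,B^m)$ is an $m$-dimensional fractional Brownian motion on $[0,T]$, i.e. a continuous centered Gaussian process with $\mathbb{E}(B^i_tB^j_s)=\frac{\delta_{ij}}{2}\big(t^{2H_i}+s^{2H_i}-|t-s|^{2H_i}\big)$. $|\cdot|$ is the Euclidean norm on vectors; $\partial^i b$ is the tensor of all partial derivatives of order $i$ of $b$ ($\partial^0b=b$), with the norm of a matrix being the operator norm and any fixed norm on higher tensors. A partition is $\pi:0=t_0<t_1<\dots<t_n=T$, with $|\pi|=\max_{0\le k\le n-1}(t_{k+1}-t_k)$. The interpolated backward Euler approximation $Y=Y^\pi$ satisfies $Y_0=x_0$ and, for $k=0,\dots,n-1$, $$Y_t=Y_{t_k}+b(Y_t)(t-t_k)+(B_t-B_{t_k}),\qquad t\in(t_k,t_{k+1}].$$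
   Formalization: The bounds are proved for partitions with κ|π| ≤ q, for any fixed q < 1, with C depending also on q; for arbitrary partitions the claim fails, e.g. b(x) = κx with T > 1/κ and step size approaching 1/κ. *)

(* Defs.v *)
From HB Require Import structures.
From mathcomp Require Import all_boot all_order all_algebra.
From mathcomp Require Import all_classical all_reals all_analysis.

Set Implicit Arguments.
Unset Strict Implicit.
Unset Printing Implicit Defensive.

Import Order.TTheory GRing.Theory Num.Theory.
Import numFieldNormedType.Exports.

Local Open Scope classical_set_scope.
Local Open Scope ring_scope.

(** Vectors of R^m are row vectors. The library norm on matrices is the max
    norm, hence the separate Euclidean inner product and norm. *)

Definition dot (R : realType) (m : nat) (x y : 'rV[R]_m) : R :=
  \sum_(i < m) x 0 i * y 0 i.

Definition enorm (R : realType) (m : nat) (x : 'rV[R]_m) : R :=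
  Num.sqrt (dot x x).

(** Operator norm, with respect to [enorm], of the linear map
    [v |-> v *m A]. *)
Definition opnorm (R : realType) (m : nat) (A : 'M[R]_m) : R :=
  sup [set enorm (v *m A) | v in [set v : 'rV[R]_m | enorm v <= 1]].

(** [dpart [:: i1; ...; ik] f] is [d_i1 (... (d_ik f))]. *)
Definition dpart (R : realType) (m : nat) (s : seq 'I_m)
    (f : 'rV[R]_m -> R) : 'rV[R]_m -> R :=
  foldr (fun (i : 'I_m) (g : 'rV[R]_m -> R) (x : 'rV[R]_m) =>
           'D_(delta_mx 0 i) g x) f s.

Definition coordf (R : realType) (m : nat) (b : 'rV[R]_m -> 'rV[R]_m)
    (j : 'I_m) : 'rV[R]_m -> R :=
  fun x => b x 0 j.

(** All partial derivatives up to order [k] of all the coordinates exist and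
    are continuous. *)
Definition classC (R : realType) (m k : nat) (b : 'rV[R]_m -> 'rV[R]_m) : Prop :=
  forall j : 'I_m,
    (forall s : seq 'I_m, (size s <= k)%N ->
       continuous (dpart s (coordf b j))) /\
    (forall s : seq 'I_m, (size s < k)%N ->
       forall (i : 'I_m) (x : 'rV[R]_m),
         derivable (dpart s (coordf b j)) x (delta_mx 0 i)).

(** The matrix of first order partial derivatives; row [i], column [j] holds
    [d_i b_j], so that [v *m jac b x] is the derivative of [b] along [v]. *)
Definition jac (R : realType) (m : nat) (b : 'rV[R]_m -> 'rV[R]_m)
    (x : 'rV[R]_m) : 'M[R]_m :=
  \matrix_(i, j) dpart [:: i] (coordf b j) x.

Definition tensor (R : realType) (m k : nat) :=
  {ffun 'I_m * k.-tuple 'I_m -> R^o}.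

Definition dtensor (R : realType) (m k : nat) (b : 'rV[R]_m -> 'rV[R]_m)
    (x : 'rV[R]_m) : tensor R m k :=
  [ffun p => dpart (tval p.2) (coordf b p.1) x].

Definition is_norm (R : realType) (V : lmodType R) (N : V -> R) : Prop :=
  [/\ forall u v, N (u + v) <= N u + N v,
      forall a u, N (a *: u) = `|a| * N u
    & forall u, N u = 0 -> u = 0].

Definition one_sided_lipschitz (R : realType) (m : nat) (kappa : R)
    (b : 'rV[R]_m -> 'rV[R]_m) : Prop :=
  forall x y, dot (x - y) (b x - b y) <= kappa * enorm (x - y) ^+ 2.

(** [N2] and [N3] are the norms used on the derivatives of order 2 and 3. *)
Definition poly_growth3 (R : realType) (m : nat)
    (N2 : tensor R m 2 -> R) (N3 : tensor R m 3 -> R) (kappa mu : R)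
    (b : 'rV[R]_m -> 'rV[R]_m) : Prop :=
  forall x,
    Num.max (Num.max (enorm (b x)) (opnorm (jac b x)))
            (Num.max (N2 (dtensor 2 b x)) (N3 (dtensor 3 b x)))
    <= kappa * (1 + enorm x `^ mu).

Section Processes.
Context {R : realType} {d : measure_display} {Omega : measurableType d}.
Variable P : probability Omega R.

(** The library's [normal_prob 0 0] is not a Dirac mass (it is the uniform law
    on [0, 1]), hence the separate degenerate case. *)
Definition centered_gaussian (Z : Omega -> R) : Prop :=
  measurable_fun setT Z /\
  exists sigma : R, forall A : set R, measurable A ->
    P (Z @^-1` A) = if sigma == 0 then \d_(0 : R) A else normal_prob 0 sigma A.

(** Processes are indexed by the whole of [R], but only their values at times
    in [0, T] are ever constrained or used. *)
Definition process (m : nat) (T : R) (Z : R -> Omega -> 'rV[R]_m) : Prop :=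
  forall t, t \in `[0, T] -> forall i : 'I_m,
    measurable_fun setT (fun w => Z t w 0 i).

Definition fBm (m : nat) (T : R) (H : 'I_m -> R)
    (B : R -> Omega -> 'rV[R]_m) : Prop :=
  [/\ process T B,
      {ae P, forall w, {within `[0, T], continuous (fun t => B t w)}},
      forall (n : nat) (t : 'I_n -> R) (a : 'I_n -> 'rV[R]_m),
        (forall k, t k \in `[0, T]) ->
        centered_gaussian (fun w => \sum_(k < n) dot (a k) (B (t k) w))
    & forall (t s : R) (i j : 'I_m), t \in `[0, T] -> s \in `[0, T] ->
        'E_P[(fun w => B t w 0 i * B s w 0 j)%R]%E =
        ((i == j)%:R / 2 *
          (t `^ (2 * H i) + s `^ (2 * H i) - `|t - s| `^ (2 * H i)))%:E].

(** The integral is taken coordinatewise. Continuity of the paths is implicit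
    in the integral equation; it is stated because [Rintegral] also has a value
    on functions that are not integrable. *)
Definition sde_solution (m : nat) (T : R) (x0 : 'rV[R]_m)
    (b : 'rV[R]_m -> 'rV[R]_m) (B X : R -> Omega -> 'rV[R]_m) : Prop :=
  process T X /\
  {ae P, forall w,
     {within `[0, T], continuous (fun t => X t w)} /\
     forall t, t \in `[0, T] -> forall i : 'I_m,
       X t w 0 i = x0 0 i
         + (\int[lebesgue_measure]_(s in `[0, t]) (b (X s w) 0 i))%R
         + B t w 0 i}.

(** The partition [0 = t_0 < ... < t_n = T] is the list [tau = [t_1; ...; t_n]]
    with [itv_partition 0 T tau]; its points are [ptime tau 0, ..., ptime tau n]
    where [n = size tau]. *)
Definition ptime (tau : seq R) (k : nat) : R := nth 0 (0 :: tau) k.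

Definition mesh (tau : seq R) : R :=
  \big[Num.max/0]_(k < size tau) (ptime tau k.+1 - ptime tau k).

Definition backward_euler (m : nat) (T : R) (x0 : 'rV[R]_m)
    (b : 'rV[R]_m -> 'rV[R]_m) (B : R -> Omega -> 'rV[R]_m) (tau : seq R)
    (Y : R -> Omega -> 'rV[R]_m) : Prop :=
  process T Y /\
  {ae P, forall w,
     Y 0 w = x0 /\
     forall k : nat, (k < size tau)%N ->
     forall t, t \in `]ptime tau k, ptime tau k.+1] ->
       Y t w = Y (ptime tau k) w + (t - ptime tau k) *: b (Y t w)
               + (B t w - B (ptime tau k) w)}.

End Processes.

(* Main.v *)
Require Import Defs.
From HB Require Import structures.
From mathcomp Require Import all_boot all_order all_algebra.
From mathcomp Require Import all_classical all_reals all_analysis.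
From mathcomp Require Import measurable_realfun ring lra.
Set Implicit Arguments.
Unset Strict Implicit.
Unset Printing Implicit Defensive.
Import Order.TTheory GRing.Theory Num.Theory.
Import numFieldNormedType.Exports.
Local Open Scope classical_set_scope.
Local Open Scope ring_scope.

(** The rate is one, above the Hoelder regularity of the noise, because the local
    errors of the scheme cancel. Write [e = Y - X] on the partition. Comparing
    the scheme with the integral equation gives
      [e_(k+1) = e_k + h_k (b Y_(k+1) - b X_(k+1)) + R_k],
    where [R_k] is the integral of [b X_(t_(k+1)) - b X_s] over the [k]-th
    interval ([defect]). Each [R_k] has only the size [h ^ (1 + H)], but their
    sums are of order [h]: to first order [R_k] is the matrix of partial
    derivatives of [b] at [X_(t_(k+1))] applied to the integral of
    [B_(t_(k+1)) - B_s], and the partial sums of these integrals form a path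
    that is [h] times a path as regular as [B] itself.

    This last fact is the probabilistic input. The accumulated noise is an
    integral against [B] of a step function with values in [0, h]. For [H > 1/2]
    increments of [B] over any two intervals are nonnegatively correlated
    ([norm_powR_four_points]), so the second moment only grows when the step
    function is replaced by [h], and then a single increment of [B] remains
    ([weighted_increments_moment]). Being Gaussian, the process has moments of
    all orders controlled in the same way ([gaussian_moment]). By Kolmogorov's
    argument ([integral_dyadic_sum], [holder_of_dyadic]) both [B] and the
    accumulated noise divided by [h] are Hoelder continuous of an exponent
    [alpha > 1/2], with a constant [K] whose moments do not depend on the
    partition.

    Everything else holds path by path. As [2 * alpha > 1], the weighted sum of
    the increments of the accumulated noise is a discrete Young integral, hence
    of order [h] ([discrete_young]), and the second order Taylor remainders,
    squares of path increments, are of order [h] as well ([defect_linear],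
    [defects_le]). Subtracting the accumulated defects from [e] leaves an
    implicit recursion whose drift is one-sided Lipschitz up to an error of
    order [h], and a discrete Gronwall lemma concludes ([pathwise_error]). The
    same lemma bounds [X], which is an implicit scheme on a fine grid up to a
    small perturbation ([enorm_path]). All constants grow polynomially in [K]
    ([poly_bounded_error_bound]), so the square of the error is at most
    [h ^+ 2] times a random variable with a finite mean. *)

(** * Euclidean norm *)

Section Enorm.
Context {R : realType} {m : nat}.
Implicit Types (x y z : 'rV[R]_m) (a : R).

Lemma dotC x y : dot x y = dot y x.
Proof. by apply: eq_bigr => i _; rewrite mulrC. Qed.

Lemma dotDl x y z : dot (x + y) z = dot x z + dot y z.
Proof. by rewrite /dot -big_split; apply: eq_bigr => i _; rewrite mxE mulrDl. Qed.

Lemma dotDr x y z : dot z (x + y) = dot z x + dot z y.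
Proof. by rewrite dotC dotDl !(dotC z). Qed.

Lemma dotZl a x y : dot (a *: x) y = a * dot x y.
Proof. by rewrite /dot mulr_sumr; apply: eq_bigr => i _; rewrite mxE mulrA. Qed.

Lemma dotZr a x y : dot x (a *: y) = a * dot x y.
Proof. by rewrite dotC dotZl dotC. Qed.

Lemma dot_ge0 x : 0 <= dot x x.
Proof. by apply: sumr_ge0 => i _; rewrite -expr2 sqr_ge0. Qed.

Lemma enorm_ge0 x : 0 <= enorm x.
Proof. exact: sqrtr_ge0. Qed.

Lemma sqr_enorm x : enorm x ^+ 2 = dot x x.
Proof. by rewrite sqr_sqrtr // dot_ge0. Qed.

Lemma coord_le_enorm x (i : 'I_m) : `|x 0 i| <= enorm x.
Proof.
rewrite -(ler_pXn2r (n := 2)) ?nnegrE ?enorm_ge0// sqr_enorm /dot (bigD1 i)//=.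
rewrite real_normK ?num_real// -expr2 lerDl; apply: sumr_ge0 => j _.
by rewrite -expr2 sqr_ge0.
Qed.

Lemma enorm_eq0 x : enorm x = 0 -> x = 0.
Proof.
move=> e; apply/rowP => i; rewrite mxE; apply/eqP; rewrite -normr_le0 -e.
exact: coord_le_enorm.
Qed.

Lemma dot_le_enorm x y : dot x y <= enorm x * enorm y.
Proof.
have d0 z : dot 0 z = 0 by rewrite -(scale0r 0) dotZl mul0r.
have X := enorm_ge0 x; have Y := enorm_ge0 y.
move: X; rewrite le_eqVlt => /predU1P[/esym/enorm_eq0 ->|X].
  by rewrite d0 mulr_ge0// enorm_ge0.
move: Y; rewrite le_eqVlt => /predU1P[/esym/enorm_eq0 ->|Y].
  by rewrite dotC d0 mulr_ge0// enorm_ge0.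
have h : 0 <= 2 * (enorm x * enorm y) * (enorm x * enorm y - dot x y).
  have := dot_ge0 (enorm y *: x + (- enorm x) *: y).
  rewrite !(dotDl, dotDr, dotZl, dotZr) (dotC y x) -!sqr_enorm; lra.
by move: h; rewrite pmulr_rge0 ?subr_ge0// !mulr_gt0.
Qed.

Lemma ler_enormD x y : enorm (x + y) <= enorm x + enorm y.
Proof.
rewrite -(ler_pXn2r (n := 2)) ?nnegrE ?addr_ge0 ?enorm_ge0//.
rewrite sqr_enorm !(dotDl, dotDr) (dotC y x) sqrrD !sqr_enorm.
by have := dot_le_enorm x y; lra.
Qed.

Lemma enormZ a x : enorm (a *: x) = `|a| * enorm x.
Proof. by rewrite /enorm dotZl dotZr mulrA -expr2 sqrtrM ?sqr_ge0// sqrtr_sqr. Qed.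

Lemma enormN x : enorm (- x) = enorm x.
Proof. by rewrite -scaleN1r enormZ normrN1 mul1r. Qed.

Lemma enorm0 : enorm (0 : 'rV[R]_m) = 0.
Proof. by rewrite -(scale0r 0) enormZ normr0 mul0r. Qed.

Lemma enorm_le_sum x : enorm x <= \sum_i `|x 0 i|.
Proof.
rewrite -(ler_pXn2r (n := 2)) ?nnegrE ?enorm_ge0 ?sumr_ge0//.
rewrite sqr_enorm expr2 mulr_suml /dot; apply: ler_sum => i _.
rewrite -expr2 -real_normK ?num_real// expr2 ler_wpM2l//.
by rewrite [leRHS](bigD1 i)//= lerDl; apply: sumr_ge0 => j _.
Qed.

Lemma enorm_le_const x c : (forall i, `|x 0 i| <= c) -> enorm x <= m%:R * c.
Proof.
move=> h; apply: (le_trans (enorm_le_sum x)).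
apply: (le_trans (ler_sum _ (fun i _ => h i))).
by rewrite sumr_const card_ord mulr_natl.
Qed.

End Enorm.

(** * Elementary bounds on steps and powers *)

Lemma nondecreasing_steps {R : realType} (n : nat) (t : nat -> R) :
  (forall k, (k < n)%N -> t k <= t k.+1) -> forall k l, (k <= l <= n)%N -> t k <= t l.
Proof.
move=> tS k l /andP[kl ln]; elim: l kl ln => [|l IH]; first by rewrite leqn0 => /eqP ->.
rewrite leq_eqVlt => /predU1P[->//|]; rewrite ltnS => kl ln.
exact: le_trans (IH kl (ltnW ln)) (tS _ ln).
Qed.

Lemma half_powR_lt1 {R : realType} (a : R) : 0 < a -> 2^-1 `^ a < 1.
Proof. by move=> a0; have := @gt0_ltr_powR R _ a0 2^-1 1; rewrite powR1 !nnegrE; apply; lra. Qed.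

(** * Estimates on the drift *)

Section CoordinateMVT.
Context {R : realType} {m : nat}.
Implicit Types (f : 'rV[R]_m -> R) (x y v : 'rV[R]_m).

Lemma is_derive_line f x v :
  (forall z, derivable f z v) ->
  forall t : R, is_derive t 1 (fun s : R => f (x + s *: v)) ('D_v f (x + t *: v)).
Proof.
move=> df t; set g := fun s : R => f (x + s *: v).
have E : (fun h : R => h^-1 *: ((g \o shift t) (h *: 1) - g t)) =
         (fun h : R => h^-1 *: ((f \o shift (x + t *: v)) (h *: v) - f (x + t *: v))).
  apply/funext => h; congr (_ *: (_ - _)).
  by rewrite /g /= [h *: 1]mulr1 scalerDl addrCA.
apply: DeriveDef; first by rewrite /derivable E; exact: df.
by rewrite /derive E.
Qed.

Lemma MVT_line f x v (h : R) : (forall z, derivable f z v) ->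
  exists2 s : R, `|s| <= `|h| & f (x + h *: v) - f x = h * 'D_v f (x + s *: v).
Proof.
move=> df; have dg := is_derive_line x df.
have cg (a b : R) : {within `[a, b], continuous (fun s : R => f (x + s *: v))}.
  apply: derivable_within_continuous => t _; apply: ex_derive; exact: dg.
have [h0|h0] := leP 0 h.
  have [c] := MVT_segment h0 (fun t _ => dg t) (cg 0 h).
  rewrite in_itv/= => /andP[c0 ch]; rewrite scale0r addr0 subr0 => e.
  by exists c; rewrite ?e 1?mulrC// !ger0_norm.
have [c] := MVT_segment (ltW h0) (fun t _ => dg t) (cg h 0).
rewrite in_itv/= => /andP[hc c0]; rewrite scale0r addr0 sub0r => e.
exists c; first by rewrite !ler0_norm ?lerN2// ltW.
by rewrite -opprB e mulrN opprK mulrC.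
Qed.

(** The increment is split along the broken line from [x] to [y] that changes
    one coordinate at a time, so that the one-dimensional mean value theorem
    applies to each piece. *)
Lemma coordinate_MVT f x y :
  (forall i z, derivable f z (delta_mx 0 i)) ->
  exists xi : 'I_m -> 'rV[R]_m,
    (forall i k, `|xi i 0 k - x 0 k| <= `|y 0 k - x 0 k|) /\
    f y - f x = \sum_(i < m) (y 0 i - x 0 i) * 'D_(delta_mx 0 i) f (xi i).
Proof.
move=> df.
pose p (j : nat) : 'rV[R]_m := \row_(k < m) if (k < j)%N then y 0 k else x 0 k.
have pm : p m = y by apply/rowP => k; rewrite mxE ltn_ord.
have p0 : p 0 = x by apply/rowP => k; rewrite mxE.
have pS (i : 'I_m) : p i.+1 = p i + (y 0 i - x 0 i) *: delta_mx 0 i.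
  apply/rowP => k; rewrite !mxE eqxx/= ltnS leq_eqVlt -val_eqE/=.
  have [e|ne] := eqVneq (k : nat) i; last by rewrite mulr0 addr0.
  by rewrite e ltnn mulr1 (_ : k = i) 1?addrC ?subrK//; apply: val_inj.
have /choice[s hs] : forall i : 'I_m, exists s : R,
    `|s| <= `|y 0 i - x 0 i| /\
    f (p i.+1) - f (p i) = (y 0 i - x 0 i) * 'D_(delta_mx 0 i) f (p i + s *: delta_mx 0 i).
  move=> i; have [s s1 s2] := MVT_line (p i) (y 0 i - x 0 i) (df i).
  by exists s; rewrite pS.
exists (fun i : 'I_m => p i + s i *: delta_mx 0 i); split=> [i k|].
  rewrite !mxE eqxx/=; have [si _] := hs i.
  have [->|ne] := eqVneq k i; first by rewrite ltnn mulr1 addrAC subrr add0r.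
  by rewrite mulr0 addr0; case: ifP => // _; rewrite subrr normr0.
have <- : \sum_(i < m) (f (p i.+1) - f (p i)) = f y - f x.
  by rewrite -(big_mkord xpredT (fun j => f (p j.+1) - f (p j))) telescope_sumr// pm p0.
by apply: eq_bigr => i _; have [_ ->] := hs i.
Qed.

End CoordinateMVT.

Lemma is_norm_ge0 (R : realType) (V : lmodType R) (N : V -> R) (u : V) :
  is_norm N -> 0 <= N u.
Proof.
case=> ND NZ _.
have Nz : N 0 = 0 by rewrite -(scale0r 0) NZ normr0 mul0r.
have NN : N (- u) = N u by rewrite -scaleN1r NZ normrN1 mul1r.
by have := ND u (- u); rewrite NN subrr Nz; lra.
Qed.

Section NormEquivalence.
Context {R : realType} {I : finType}.

Lemma coord_le_mxnorm n (v : 'rV[R]_n) k : `|v 0 k| <= `|v|.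
Proof.
by rewrite [leRHS]/Num.norm /= mx_normrE; apply/bigmax_geP; right => /=; exists (0, k).
Qed.

(** A norm attains a positive minimum on the compact unit sphere. *)
Lemma coord_le_norm (N : {ffun I -> R^o} -> R) : is_norm N ->
  exists c : R, 0 <= c /\ forall (u : {ffun I -> R^o}) (p : I), `|u p : R| <= c * N u.
Proof.
move=> nN; have Nge0 u := is_norm_ge0 u nN; case: nN => ND NZ N0.
have Nz : N 0 = 0 by rewrite -(scale0r 0) NZ normr0 mul0r.
pose phi (v : 'rV[R]_#|I|) : {ffun I -> R^o} := [ffun i => v 0 (enum_rank i)].
have phiB v w : phi (v - w) = phi v - phi w.
  by apply/ffunP => i; rewrite !ffunE !mxE.
have phiZ a v : phi (a *: v) = a *: phi v.
  by apply/ffunP => i; rewrite !ffunE !mxE.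
pose A := \sum_(k < #|I|) N (phi (delta_mx 0 k)).
have Nphi v : N (phi v) <= A * `|v|.
  have -> : phi v = \sum_k v 0 k *: phi (delta_mx 0 k).
    apply/ffunP => i; rewrite sum_ffunE !ffunE [in LHS](row_sum_delta v).
    by rewrite summxE; apply: eq_bigr => k _; rewrite !ffunE !mxE.
  rewrite mulr_suml; elim/big_ind2 : _ => [|x1 x2 y1 y2 h1 h2|k _].
  - by rewrite Nz.
  - exact: (le_trans (ND _ _) (lerD h1 h2)).
  - by rewrite NZ mulrC ler_wpM2l// coord_le_mxnorm.
have cN : continuous (fun v : 'rV[R]_#|I| => N (phi v)).
  move=> v; apply/(cvgrPdist_le (FF := nbhs_filter v)) => /= e e0.
  have A0 : 0 < A + 1 by rewrite ltr_wpDl// sumr_ge0.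
  have nb : \forall w \near v, `|v - w| <= e / (A + 1).
    have e0' : 0 < e / (A + 1) by rewrite divr_gt0.
    near=> w; suff : ball v (e / (A + 1)) w by rewrite mx_norm_ball => /ltW.
    by near: w; exact: (nbhsx_ballx v _ e0').
  near=> w.
  have vw : `|v - w| <= e / (A + 1).
    by near: w; exact: nb.
  have h1 := ND (phi w) (phi (v - w)); have h2 := ND (phi v) (phi (w - v)).
  have h3 := Nphi (v - w); have h4 := Nphi (w - v).
  rewrite distrC in h4; rewrite phiB addrC subrK -phiB in h1.
  rewrite phiB addrC subrK -phiB in h2.
  have h5 : A * `|v - w| <= e.
    apply: (@le_trans _ _ ((A + 1) * `|v - w|)); first by rewrite ler_wpM2r// lerDl.
    by rewrite mulrC -ler_pdivlMr.
  by rewrite ler_norml; apply/andP; split; lra.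
pose S := [set v : 'rV[R]_#|I| | `|v| = 1].
have cS : compact S.
  apply: bounded_closed_compact.
    by exists 1; split => // x x1 v /= ->; exact: ltW.
  rewrite (_ : S = (fun v => `|v|) @^-1` [set 1])//.
  by apply: preimage_closed; [move=> ? _; exact: norm_continuous|exact: closed_eq].
have uphi (u : {ffun I -> R^o}) : u = phi (\row_k u (enum_val k)).
  by apply/ffunP => i; rewrite ffunE mxE enum_rankK.
have nS v : v != 0 -> S (`|v|^-1 *: v).
  by move=> v0; rewrite /S/= normrZ normfV normr_id mulVf// normr_eq0.
have [Sne|Se] := pselect (S !=set0); last first.
  exists 0; split=> // u p; rewrite mul0r; move: (\row_k u (enum_val k)) (uphi u) => v ->.
  have [->|v0] := eqVneq v 0; first by rewrite ffunE mxE normr0.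
  by exfalso; apply: Se; exists (`|v|^-1 *: v); exact: nS.
have [v0 v0S minv] := EVT_min_rV Sne cS (continuous_subspaceT cN).
rewrite inE in v0S; pose c := N (phi v0).
have c0 : 0 < c.
  rewrite lt_neqAle Nge0 andbT eq_sym; apply/eqP => /N0 /ffunP e.
  have : `|v0| = 0.
    suff -> : v0 = 0 by rewrite normr0.
    apply/rowP => k; rewrite mxE; have := e (enum_val k).
    by rewrite !ffunE enum_valK.
  by rewrite v0S; apply/eqP; rewrite oner_eq0.
exists c^-1; split=> [|u p]; first by rewrite invr_ge0 ltW.
move: (\row_k u (enum_val k)) (uphi u) => v ->.
rewrite [in leLHS]ffunE; apply: (le_trans (coord_le_mxnorm _ _)).
have [->|vn0] := eqVneq v 0; first by rewrite normr0 mulr_ge0// invr_ge0 ltW.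
rewrite mulrC ler_pdivlMr// mulrC.
have := minv (`|v|^-1 *: v); rewrite inE => /(_ (nS _ vn0)).
rewrite phiZ NZ normfV normr_id -/c => h.
by rewrite -ler_pdivlMr ?normr_gt0// mulrC.
Unshelve. all: by end_near. Qed.

End NormEquivalence.

(** With [g i j] in the role of the partial derivative [d_i b_j]: size, Lipschitz
    and first order Taylor bounds on the ball of radius [r], with one constant
    of polynomial growth in [r]. *)
Definition drift_bounds {R : realType} {m : nat} (C : R) (D : nat)
    (b : 'rV[R]_m -> 'rV[R]_m) (g : 'I_m -> 'I_m -> 'rV[R]_m -> R) : Prop :=
  forall r x y, enorm x <= r -> enorm y <= r ->
      let L := C * (1 + r) ^+ D in
      forall j,
      [/\ `|b x 0 j| <= L,
          `|b y 0 j - b x 0 j| <= L * enorm (y - x),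
          forall i, `|g i j x| <= L,
          forall i, `|g i j y - g i j x| <= L * enorm (y - x)
        & `|b y 0 j - b x 0 j - \sum_(i < m) g i j x * (y 0 i - x 0 i)|
            <= L * enorm (y - x) ^+ 2].


Section DriftEstimates.
Context {R : realType} {m : nat}.
Implicit Types (f : 'rV[R]_m -> R) (x y z : 'rV[R]_m).

Lemma entry_le_opnorm (A : 'M[R]_m) i j : `|A i j| <= opnorm A.
Proof.
have -> : A i j = ((delta_mx 0 i : 'rV[R]_m) *m A) 0 j by rewrite -rowE mxE.
apply: (le_trans (coord_le_enorm _ _)); apply: ub_le_sup.
  exists (m%:R * \sum_i \sum_j `|A i j|) => _ [v /= v1 <-].
  apply: enorm_le_const => k; rewrite mxE.
  apply: (le_trans (ler_norm_sum _ _ _)); apply: ler_sum => l _.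
  rewrite normrM (bigD1 k)//= -[leLHS]addr0 lerD ?sumr_ge0//.
  by rewrite ler_piMl// (le_trans (coord_le_enorm _ _)).
exists (delta_mx 0 i) => //=.
suff -> : enorm (delta_mx 0 i : 'rV[R]_m) = 1 by [].
rewrite /enorm /dot (bigD1 i)//= big1 ?addr0; first by rewrite mxE !eqxx mulr1 sqrtr1.
by move=> k ki; rewrite mxE eqxx (negbTE ki) mulr0.
Qed.

Lemma lipschitz_of_partials f W x y :
  (forall i z, derivable f z (delta_mx 0 i)) ->
  (forall i z, (forall k, `|z 0 k - x 0 k| <= `|y 0 k - x 0 k|) ->
     `|'D_(delta_mx 0 i) f z| <= W) ->
  `|f y - f x| <= m%:R * W * enorm (y - x).
Proof.
move=> df bf; have [xi [hxi ->]] := coordinate_MVT x y df.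
apply: (le_trans (ler_norm_sum _ _ _)).
apply: (@le_trans _ _ (\sum_(i < m) W * enorm (y - x))).
  apply: ler_sum => i _; rewrite normrM mulrC ler_pM//; first exact: bf.
  by have := coord_le_enorm (y - x) i; rewrite !mxE.
by rewrite sumr_const card_ord -mulrA mulr_natl.
Qed.

(** The remainder is the change of each first derivative between [x] and the
    intermediate point of its coordinate, which the second derivatives control. *)
Lemma taylor1_of_partials f W x y :
  (forall i z, derivable f z (delta_mx 0 i)) ->
  (forall i k z, derivable ('D_(delta_mx 0 i) f) z (delta_mx 0 k)) ->
  (forall i k z, (forall l, `|z 0 l - x 0 l| <= `|y 0 l - x 0 l|) ->
     `|'D_(delta_mx 0 k) ('D_(delta_mx 0 i) f) z| <= W) ->
  `|f y - f x - \sum_(i < m) 'D_(delta_mx 0 i) f x * (y 0 i - x 0 i)|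
    <= m%:R ^+ 3 * W * enorm (y - x) ^+ 2.
Proof.
move=> df d2f b2f; have [xi [hxi ->]] := coordinate_MVT x y df.
rewrite -sumrB; apply: (le_trans (ler_norm_sum _ _ _)).
apply: (@le_trans _ _ (\sum_(i < m) (m%:R ^+ 2 * W * enorm (y - x) ^+ 2))).
  apply: ler_sum => i _; rewrite [_ * (y 0 i - _)]mulrC -mulrBr normrM.
  have W0 : 0 <= W.
    by apply: le_trans (b2f i i x _) => // k; rewrite subrr normr0.
  have h1 : `|y 0 i - x 0 i| <= enorm (y - x).
    by have := coord_le_enorm (y - x) i; rewrite !mxE.
  have h2 : enorm (xi i - x) <= m%:R * enorm (y - x).
    apply: enorm_le_const => k; rewrite !mxE; apply: (le_trans (hxi i k)).
    by have := coord_le_enorm (y - x) k; rewrite !mxE.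
  have h3 := lipschitz_of_partials (d2f i) (fun k z hz => b2f i k z
               (fun l => le_trans (hz l) (hxi i l))).
  apply: (@le_trans _ _ (enorm (y - x) * (m%:R * W * (m%:R * enorm (y - x))))).
    apply: ler_pM => //; apply: (le_trans h3).
    by rewrite ler_wpM2l// mulr_ge0.
  by rewrite le_eqVlt; apply/orP; left; apply/eqP; ring.
rewrite sumr_const card_ord -mulr_natl le_eqVlt.
by apply/orP; left; apply/eqP; ring.
Qed.

(** The intermediate points of the coordinatewise mean value theorems lie in a
    ball of radius [3 m r]; there the growth condition bounds [b], its
    Jacobian entries and its second derivatives, the latter through the
    equivalence of [N2] with the maximum norm. *)
Lemma drift_estimates (N2 : tensor R m 2 -> R) (N3 : tensor R m 3 -> R)
    (kappa mu : R) : is_norm N2 -> 0 <= mu ->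
  exists (C : R) (D : nat), 0 <= C /\
    forall b, classC 3 b -> poly_growth3 N2 N3 kappa mu b ->
    exists g : 'I_m -> 'I_m -> 'rV[R]_m -> R, drift_bounds C D b g.
Proof.
move=> hN2 mu0; have [c2 [c20 hc2]] := coord_le_norm hN2.
pose D := (Num.truncn mu).+1.
have muD : mu <= D%:R by rewrite ltW// truncnS_gt.
pose M : R := m%:R.
have M0 : 0 <= M by rewrite ler0n.
pose C := (1 + M ^+ 3 + M) * ((1 + c2) * `|kappa| * 2 * (3 * M + 1) ^+ D).
exists C, D; split=> [|b cb gb].
  by rewrite /C !mulr_ge0 ?exprn_ge0// !addr_ge0// ?exprn_ge0// mulr_ge0.
exists (fun i j z => 'D_(delta_mx 0 i) (coordf b j) z) => r x y xr yr L j.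
have r0 : 0 <= r by apply: le_trans xr; exact: enorm_ge0.
pose W := (1 + c2) * (`|kappa| * 2 * (1 + 3 * M * r) ^+ D).
have W0 : 0 <= W.
  by rewrite /W !mulr_ge0 ?exprn_ge0// ?addr_ge0// !mulr_ge0.
have LW : (1 + M ^+ 3 + M) * W <= L.
  rewrite /L /C /W -!mulrA; do 4 rewrite ler_wpM2l ?addr_ge0 ?exprn_ge0//.
  rewrite -exprMn lerXn2r// ?nnegrE ?mulr_ge0 ?addr_ge0 ?mulr_ge0//.
  by rewrite mulrDr mulr1 mulrDl mul1r; nra.
have grow z : enorm z <= 3 * M * r ->
    kappa * (1 + enorm z `^ mu) <= `|kappa| * 2 * (1 + 3 * M * r) ^+ D.
  move=> zr; rewrite -mulrA; apply: (@le_trans _ _ (`|kappa| * (1 + enorm z `^ mu))).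
    by rewrite ler_wpM2r ?ler_norm// addr_ge0// powR_ge0.
  rewrite ler_wpM2l// mulrDl !mul1r lerD//.
    by rewrite exprn_ege1// lerDl (le_trans (enorm_ge0 z)).
  apply: (@le_trans _ _ ((1 + 3 * M * r) `^ mu)).
    have MR : 0 <= 3 * M * r by rewrite !mulr_ge0.
    by rewrite ge0_ler_powR ?nnegrE ?enorm_ge0//; lra.
  rewrite -powR_mulrn; last by rewrite addr_ge0// !mulr_ge0.
  by rewrite ler_powR// lerDl !mulr_ge0.
have B z : enorm z <= 3 * M * r -> [/\ `|b z 0 j| <= W,
   forall i, `|'D_(delta_mx 0 i) (coordf b j) z| <= W &
   forall i k, `|'D_(delta_mx 0 k) ('D_(delta_mx 0 i) (coordf b j)) z| <= W].
  move=> zr; have Q := grow z zr; have := gb z.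
  rewrite !ge_max => /andP[/andP[b0 b1] /andP[b2 _]].
  have QW : `|kappa| * 2 * (1 + 3 * M * r) ^+ D <= W.
    rewrite /W -[leLHS]mul1r ler_wpM2r ?lerDl//.
    by rewrite (le_trans _ Q)// (le_trans _ b0) ?enorm_ge0.
  split=> [|i|i k].
  - by apply: le_trans QW; apply: le_trans Q; apply: le_trans b0; exact: coord_le_enorm.
  - apply: le_trans QW; apply: le_trans Q; apply: le_trans b1.
    by have := entry_le_opnorm (jac b z) i j; rewrite mxE.
  - have := hc2 (dtensor 2 b z) (j, [tuple k; i]); rewrite ffunE /=.
    move/le_trans; apply; rewrite /W ler_pM//; first exact: is_norm_ge0.
    - by rewrite lerDr.
    - exact: le_trans Q.
have [_ db] := cb j.
have d1 i z : derivable (coordf b j) z (delta_mx 0 i) by exact: (db [::]).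
have d2 i k z : derivable ('D_(delta_mx 0 i) (coordf b j)) z (delta_mx 0 k).
  exact: (db [:: i]).
have box z : (forall k, `|z 0 k - x 0 k| <= `|y 0 k - x 0 k|) -> enorm z <= 3 * M * r.
  move=> hz; rewrite mulrAC mulrC; apply: enorm_le_const => k.
  have := hz k; have := le_trans (coord_le_enorm x k) xr.
  have := le_trans (coord_le_enorm y k) yr.
  have := ler_normD (z 0 k - x 0 k) (x 0 k).
  have := ler_normB (y 0 k) (x 0 k).
  by rewrite subrK; lra.
have xbox : enorm x <= 3 * M * r by apply: box => k; rewrite subrr normr0.
have [Bx1 Bx2 _] := B x xbox.
have L3 : M ^+ 3 * W <= L.
  by apply: le_trans LW; rewrite ler_wpM2r//; have := M0; lra.
have L2 : M * W <= L.
  by apply: le_trans LW; rewrite ler_wpM2r//; have := exprn_ge0 3 M0; lra.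
have L1 : W <= L.
  apply: le_trans LW; rewrite -[leLHS]mul1r ler_wpM2r//.
  by have := exprn_ge0 3 M0; have := M0; lra.
split.
- exact: le_trans L1.
- apply: (le_trans (lipschitz_of_partials d1 (W := W) _)).
    by move=> i z /box /B[_ + _]; exact.
  by rewrite ler_wpM2r// enorm_ge0.
- by move=> i; exact: le_trans L1.
- move=> i; apply: (le_trans (lipschitz_of_partials (d2 i) (W := W) _)).
    by move=> k z /box /B[_ _ +]; exact.
  by rewrite ler_wpM2r// enorm_ge0.
- apply: (le_trans (taylor1_of_partials d1 d2 (W := W) _)).
    by move=> i k z /box /B[_ _ +]; exact.
  by rewrite ler_wpM2r// sqr_ge0.
Qed.

End DriftEstimates.

(** * Discrete Gronwall and Young inequalities *)

Section ImplicitGronwall.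
Context {R : realType} {m : nat}.
Variables (kappa q : R).
Hypotheses (kappa0 : 0 <= kappa) (q1 : q < 1).
Let c := kappa / (1 - q).

(** Pairing the step with its endpoint [z'] makes the one-sided condition apply
    to the implicit value: [(1 - kappa h) |z'| <= |z| + h a]. Since
    [kappa h <= q < 1], the factor is at least [expR (- c h)]. *)
Lemma implicit_step (a h : R) (z z' v : 'rV[R]_m) :
  0 <= a -> 0 <= h -> kappa * h <= q ->
  z' = z + h *: v -> dot z' v <= kappa * enorm z' ^+ 2 + a * enorm z' ->
  enorm z' <= expR (c * h) * (enorm z + h * a).
Proof.
move=> a0 h0 khq e hv.
have n0 := enorm_ge0 z; have n0' := enorm_ge0 z'.
have rhs0 : 0 <= enorm z + h * a by rewrite addr_ge0// mulr_ge0.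
have kh0 : 0 <= kappa * h by rewrite mulr_ge0.
have step : (1 - kappa * h) * enorm z' <= enorm z + h * a.
  move: n0'; rewrite le_eqVlt => /predU1P[<-|n0']; first by rewrite mulr0.
  rewrite -(ler_pM2r n0').
  have : enorm z' ^+ 2 = dot z' z + h * dot z' v.
    by rewrite sqr_enorm {2}e dotDr dotZr.
  have := dot_le_enorm z' z; have := ler_wpM2l h0 hv; rewrite expr2.
  move: (dot z' z) (dot z' v) => d1 d2; clear; move: (enorm z') (enorm z) => x y; lra.
have expo : 1 <= expR (c * h) * (1 - kappa * h).
  apply: (@le_trans _ _ ((1 + c * h) * (1 - kappa * h))); last first.
    by apply: ler_wpM2r; [rewrite subr_ge0 (le_trans khq) ?ltW|exact: expR_ge1Dx].
  rewrite -subr_ge0 /c.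
  have -> : (1 + kappa / (1 - q) * h) * (1 - kappa * h) - 1 =
     (kappa * h) * (q - kappa * h) / (1 - q) by field; rewrite subr_eq0 gt_eqF.
  by rewrite divr_ge0 ?mulr_ge0// subr_ge0// ltW.
apply: (@le_trans _ _ (expR (c * h) * (1 - kappa * h) * enorm z')).
  by rewrite ler_peMl.
by rewrite -mulrA ler_wpM2l// expR_ge0.
Qed.

Lemma implicit_gronwall (a : R) (n : nat) (t : nat -> R) (z v : nat -> 'rV[R]_m) :
  0 <= a -> (forall k, (k < n)%N -> t k <= t k.+1) ->
  (forall k, (k < n)%N -> kappa * (t k.+1 - t k) <= q) ->
  (forall k, (k < n)%N -> z k.+1 = z k + (t k.+1 - t k) *: v k) ->
  (forall k, (k < n)%N ->
     dot (z k.+1) (v k) <= kappa * enorm (z k.+1) ^+ 2 + a * enorm (z k.+1)) ->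
  enorm (z n) <= expR (c * (t n - t 0%N)) * (enorm (z 0%N) + (t n - t 0%N) * a).
Proof.
move=> a0; elim: n => [|n IH] tS tq zS hv.
  by rewrite subrr mulr0 expR0 mul1r mul0r addr0.
have {}IH := IH (fun k kn => tS k (ltnW kn)) (fun k kn => tq k (ltnW kn))
  (fun k kn => zS k (ltnW kn)) (fun k kn => hv k (ltnW kn)).
have h0 : 0 <= t n.+1 - t n by rewrite subr_ge0 tS.
apply: (le_trans (implicit_step a0 h0 (tq n _) (zS n _) (hv n _))) => //.
have s0 : 0 <= t n - t 0%N.
  by rewrite subr_ge0 (nondecreasing_steps tS)// leqnSn.
have -> : t n.+1 - t 0%N = (t n.+1 - t n) + (t n - t 0%N) by ring.
move: (t n.+1 - t n) (t n - t 0%N) h0 s0 IH => h s h0 s0 IH.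
have -> : expR (c * (h + s)) = expR (c * h) * expR (c * s) by rewrite mulrDr expRD.
rewrite -[leRHS]mulrA ler_wpM2l ?expR_ge0//.
have -> : expR (c * s) * (enorm (z 0%N) + (h + s) * a) =
  expR (c * s) * (enorm (z 0%N) + s * a) + expR (c * s) * (h * a) by ring.
rewrite lerD// ler_peMl ?mulr_ge0// -expR0 ler_expR mulr_ge0//.
by rewrite /c divr_ge0// subr_ge0 ltW.
Qed.

End ImplicitGronwall.

Section DiscreteYoung.
Context {R : realType}.
Variables (alpha : R).
Let rho : R := 2^-1 `^ alpha.

Lemma sqr_half_powR : 1 / 2 < alpha -> 2 * rho ^+ 2 < 1.
Proof.
move=> a1; have e0 : 0 < alpha - 2^-1 by lra.
have h1 := half_powR_lt1 e0.
have -> : rho = 2^-1 `^ 2^-1 * 2^-1 `^ (alpha - 2^-1).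
  by rewrite /rho -powRD ?subrKC// invr_eq0 pnatr_eq0 implybT.
rewrite exprMn -powR_mulrn ?powR_ge0// -powRrM mulVf// powRr1//.
by rewrite mulrA divff// mul1r expr_lt1// powR_ge0.
Qed.

(** Each bisection costs two products of increments and multiplies the
    remaining ones by [2 * rho ^+ 2]; this is the sum of the geometric series. *)
Definition young_const : R := 2 / (1 - 2 * rho ^+ 2).

(** Bisecting the time interval at the partition step that straddles its
    midpoint costs two products of increments and leaves two halves; the costs
    sum geometrically because [2 * rho ^+ 2 < 1]. *)
Lemma discrete_young (A K : R) (t G M : nat -> R) (n : nat) :
  2 * rho ^+ 2 < 1 -> 0 < alpha -> 0 <= A -> 0 <= K ->
  (forall k l, (k <= l <= n)%N -> t k <= t l) ->
  (forall k l, (k <= l <= n)%N -> `|G l - G k| <= A * (t l - t k) `^ alpha) ->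
  (forall k l, (k <= l <= n)%N -> `|M l - M k| <= K * (t l - t k) `^ alpha) ->
  forall k l, (k <= l <= n)%N ->
    `|\sum_(k <= i < l) G i.+1 * (M i.+1 - M i) - G l * (M l - M k)|
      <= young_const * (A * K) * ((t l - t k) `^ alpha) ^+ 2.
Proof.
move=> rho1 a0 A0 K0 tm hG hM.
have c0 : 0 <= young_const by rewrite divr_ge0// subr_ge0 ltW.
have AK0 : 0 <= A * K by rewrite mulr_ge0.
move=> k l; have [N] := ubnP (l - k)%N; elim: N k l => // N IH k l lkN kln.
have [kl ln] := andP kln.
have [lk1|kl1] := leqP l k.+1.
  have -> : \sum_(k <= i < l) G i.+1 * (M i.+1 - M i) - G l * (M l - M k) = 0.
    move: kl lk1; rewrite leq_eqVlt => /predU1P[->|kl] lk.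
      by rewrite big_geq// !subrr mulr0 subr0.
    have -> : l = k.+1 by apply/eqP; rewrite eqn_leq lk.
    by rewrite big_nat1 subrr.
  by rewrite normr0; apply: mulr_ge0; [exact: mulr_ge0|rewrite exprn_ge0 ?powR_ge0].
pose mid := (t k + t l) / 2.
have tkl := tm k l kln.
have exP : exists p, (k < p <= l)%N && (mid <= t p).
  by exists l; rewrite leqnn (leq_trans _ kl1)//= /mid; lra.
case: (ex_minnP exP) => -[|p]; first by rewrite ltn0.
move=> /andP[/andP[]]; rewrite ltnS => kp pl midp minp.
have tpm : t p <= mid.
  move: kp; rewrite leq_eqVlt => /predU1P[<-|kp]; first by rewrite /mid; lra.
  rewrite leNgt; apply/negP => h; have := minp p; rewrite kp ltnW//= ltW//= => /(_ isT).
  by rewrite ltnn.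
have pl' : (p <= l)%N by exact: ltnW.
have pn : (p.+1 <= n)%N by exact: leq_trans ln.
have H1 := IH k p; have H2 := IH p.+1 l.
have {}H1 := H1 (leq_trans (ltn_sub2r (leq_ltn_trans kp pl) pl) lkN).
have {}H1 := H1 (introT andP (conj kp (ltnW pn))).
have {}H2 : `|\sum_(p.+1 <= i < l) G i.+1 * (M i.+1 - M i) - G l * (M l - M p.+1)|
      <= young_const * (A * K) * ((t l - t p.+1) `^ alpha) ^+ 2.
  apply: H2; last by rewrite pl ln.
  by apply: (@leq_trans (l - k)); [rewrite ltn_sub2l// ltnW|exact: lkN].
have -> : \sum_(k <= i < l) G i.+1 * (M i.+1 - M i) - G l * (M l - M k) =
  (\sum_(k <= i < p) G i.+1 * (M i.+1 - M i) - G p * (M p - M k)) +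
  (\sum_(p.+1 <= i < l) G i.+1 * (M i.+1 - M i) - G l * (M l - M p.+1)) -
  (G l - G p) * (M p - M k) - (G l - G p.+1) * (M p.+1 - M p).
  rewrite (big_cat_nat kp pl')/= (big_ltn pl); ring.
pose L := (t l - t k) `^ alpha.
have L0 : 0 <= L by exact: powR_ge0.
have half x : 0 <= x -> x <= (t l - t k) / 2 -> (x `^ alpha) ^+ 2 <= (rho * L) ^+ 2.
  move=> x0 xh; rewrite lerXn2r// ?nnegrE ?powR_ge0 ?mulr_ge0 ?powR_ge0//.
  rewrite /rho /L -powRM ?invr_ge0 ?subr_ge0// mulrC.
  by rewrite ge0_ler_powR// ?nnegrE ?(ltW a0)// (le_trans x0).
have tkp : t k <= t p by apply: tm; rewrite kp ltnW.
have tpl : t p.+1 <= t l by apply: tm; rewrite pl ln.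
have tpp : t p <= t p.+1 by apply: tm; rewrite leqnSn pn.
have F1 : (((t p - t k) `^ alpha) ^+ 2) <= (rho * L) ^+ 2.
  by apply: half; rewrite ?subr_ge0//; move: tpm; rewrite /mid; lra.
have F2 : (((t l - t p.+1) `^ alpha) ^+ 2) <= (rho * L) ^+ 2.
  by apply: half; rewrite ?subr_ge0//; move: midp; rewrite /mid; lra.
have mono x : 0 <= x -> x <= t l - t k -> x `^ alpha <= L.
  by move=> x0 xl; rewrite ge0_ler_powR// ?nnegrE ?(ltW a0)// (le_trans x0).
have prod u v : `|u| <= A * L -> `|v| <= K * L -> `|u * v| <= A * K * L ^+ 2.
  move=> hu hv; rewrite normrM; apply: (le_trans (ler_pM _ _ hu hv)) => //.
  by rewrite le_eqVlt; apply/orP; left; apply/eqP; ring.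
have F3 : `|(G l - G p) * (M p - M k)| <= A * K * L ^+ 2.
  apply: prod.
    by apply: (le_trans (hG p l _)); rewrite ?pl' ?ln// ler_wpM2l// mono//; lra.
  by apply: (le_trans (hM k p _)); rewrite ?kp ?(ltnW pn)// ler_wpM2l// mono//; lra.
have F4 : `|(G l - G p.+1) * (M p.+1 - M p)| <= A * K * L ^+ 2.
  apply: prod.
    by apply: (le_trans (hG p.+1 l _)); rewrite ?pl ?ln// ler_wpM2l// mono//; lra.
  by apply: (le_trans (hM p p.+1 _)); rewrite ?leqnSn ?pn// ler_wpM2l// mono//; lra.
apply: (le_trans (ler_normB _ _)); apply: (le_trans (lerD (ler_normB _ _) (lexx _))).
apply: (le_trans (lerD (lerD (ler_normD _ _) (lexx _)) (lexx _))).
have {}H1 := le_trans H1 (ler_wpM2l (mulr_ge0 c0 AK0) F1).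
have {}H2 := le_trans H2 (ler_wpM2l (mulr_ge0 c0 AK0) F2).
apply: (le_trans (lerD (lerD (lerD H1 H2) F3) F4)).
have ce : young_const * (2 * rho ^+ 2) + 2 = young_const.
  by rewrite /young_const; field; lra.
rewrite -/L -[in leRHS]ce le_eqVlt; apply/orP; left; apply/eqP; ring.
Qed.

End DiscreteYoung.

(** * Dyadic chaining *)

Section DyadicChaining.
Context {R : realType}.
Variables (rho K : R) (f : R -> R).
Hypotheses (rho0 : 0 < rho) (rho1 : rho < 1) (K0 : 0 <= K).
Hypothesis fcont : forall t, 0 <= t <= 1 -> forall e, 0 < e ->
  exists2 d, 0 < d & forall s, 0 <= s <= 1 -> `|t - s| < d -> `|f t - f s| <= e.
Hypothesis fdyad : forall j i, (i < 2 ^ j)%N ->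
  `|f (i.+1%:R / 2 ^+ j) - f (i%:R / 2 ^+ j)| <= K * rho ^+ j.

Let idx (t : R) (j : nat) : nat := Num.truncn (t * 2 ^+ j).
Let dy (t : R) (j : nat) : R := (idx t j)%:R / 2 ^+ j.

Let two_gt0 j : 0 < 2 ^+ j :> R. Proof. exact: exprn_gt0. Qed.

Let idx_itv t j : 0 <= t -> (idx t j)%:R <= t * 2 ^+ j < (idx t j).+1%:R.
Proof. by move=> t0; apply: truncn_itv; rewrite mulr_ge0// ltW. Qed.

Let dy_le t j : 0 <= t -> 0 <= dy t j <= t.
Proof.
move=> t0; have /andP[h _] := idx_itv j t0.
by rewrite divr_ge0//= /dy ?ler_pdivrMr// ltW.
Qed.

Let dy_dist t j : 0 <= t -> `|t - dy t j| < 2^-1 ^+ j.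
Proof.
move=> t0; have /andP[_ h] := idx_itv j t0; have /andP[_ h'] := dy_le j t0.
rewrite ger0_norm ?subr_ge0// exprVn -[ltRHS]mul1r ltrBlDr -mulrDl.
by rewrite ltr_pdivlMr// addrC natr1.
Qed.

Let idxS t j : 0 <= t -> idx t j.+1 = (idx t j).*2 \/ idx t j.+1 = (idx t j).*2.+1.
Proof.
move=> t0; have /andP[a b] := idx_itv j t0; have /andP[c d] := idx_itv j.+1 t0.
have e : t * 2 ^+ j.+1 = 2 * (t * 2 ^+ j) by rewrite exprS; ring.
have h1 : ((idx t j).*2 < (idx t j.+1).+1)%N.
  by rewrite -(ltr_nat R) (le_lt_trans _ d)// e -muln2 natrM mulrC ler_pM2l.
have h2 : (idx t j.+1 < (idx t j).*2.+2)%N.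
  rewrite -(ltr_nat R) (le_lt_trans c)// e.
  by rewrite -doubleS -muln2 natrM mulrC ltr_pM2r.
move: h2; rewrite ltnS leq_eqVlt => /predU1P[->|h2]; [by right|left].
by apply/eqP; rewrite eqn_leq -ltnS h2.
Qed.

Let dyS t j : 0 <= t <= 1 -> `|f (dy t j.+1) - f (dy t j)| <= K * rho ^+ j.+1.
Proof.
move=> /andP[t0 t1].
have dbl i : (i.*2)%:R / 2 ^+ j.+1 = i%:R / 2 ^+ j :> R.
  rewrite -muln2 natrM exprS invfM; field.
  by rewrite expf_neq0.
rewrite {1 2}/dy -dbl; have [->|e] := idxS j t0.
  by rewrite subrr normr0 mulr_ge0// exprn_ge0// ltW.
rewrite e; apply: fdyad; rewrite -(ltr_nat R).
rewrite natrX; have /andP[c _] := idx_itv j.+1 t0.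
apply: (@lt_le_trans _ _ (idx t j.+1)%:R); first by rewrite e ltr_nat.
by rewrite (le_trans c)// ler_piMl// ltW.
Qed.

Let dy_chain t j k : 0 <= t <= 1 ->
  `|f (dy t (j + k)) - f (dy t j)| <= K * (rho ^+ j - rho ^+ (j + k)) / (1 - rho).
Proof.
move=> t01; have r1 : 0 < 1 - rho by rewrite subr_gt0.
elim: k => [|k IH]; first by rewrite addn0 !subrr normr0 mulr0 mul0r.
rewrite -(subrKA (f (dy t (j + k)))) (le_trans (ler_normD _ _))//.
have step : K * rho ^+ (j + k).+1 <= K * rho ^+ (j + k).
  by rewrite ler_wpM2l// exprS ler_piMl ?exprn_ge0// ltW.
rewrite addnS (le_trans (lerD (le_trans (dyS _ t01) step) IH))//.
rewrite exprS le_eqVlt; apply/orP; left; apply/eqP; field.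
by rewrite gt_eqF.
Qed.

Let dy_lim t j : 0 <= t <= 1 -> `|f t - f (dy t j)| <= K * rho ^+ j / (1 - rho).
Proof.
move=> t01; have /andP[t0 t1] := t01; apply/ler_addgt0Pr => e e0.
have [d d0 hd] := fcont t01 e0.
have [n hn] : exists n, 2^-1 ^+ n < d.
  pose n := Num.truncn (d^-1); exists n.
  rewrite exprVn invf_plt ?posrE//; apply: (@lt_le_trans _ _ n.+1%:R).
    by rewrite truncnS_gt// invr_ge0 ltW.
  by rewrite -natrX ler_nat ltn_expl.
have h1 : `|f t - f (dy t (j + n))| <= e.
  apply: hd; first by have /andP[-> h] := dy_le (j + n) t0; rewrite (le_trans h).
  apply: (lt_trans (dy_dist _ t0)); apply: le_lt_trans hn.
  by rewrite exprD ler_piMl ?exprn_ge0// exprn_ile1//; lra.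
rewrite -(subrKA (f (dy t (j + n)))) (le_trans (ler_normD _ _))//.
rewrite addrC lerD// (le_trans (dy_chain j n t01))//.
rewrite ler_wpM2r ?invr_ge0 ?subr_ge0 ?(ltW rho1)// ler_wpM2l// gerBl exprn_ge0//.
exact: ltW.
Qed.

(** Dyadic approximations of two points at distance about [2 ^- j] are equal or
    adjacent at level [j]; the tails are geometric series. *)
Lemma dyadic_chaining s t : 0 <= s -> s < t -> t <= 1 ->
  exists j, t - s <= 2^-1 ^+ j /\ 2^-1 ^+ j < 2 * (t - s) /\
    `|f t - f s| <= (1 + 2 / (1 - rho)) * K * rho ^+ j.
Proof.
move=> s0 st t1; have ts0 : 0 < t - s by rewrite subr_gt0.
have t01 : 0 <= t <= 1 by rewrite t1 ltW// (le_lt_trans s0).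
have s01 : 0 <= s <= 1 by rewrite s0 (le_trans (ltW st)).
have exj : exists j, 2^-1 ^+ j.+1 < t - s.
  pose n := Num.truncn ((t - s)^-1); exists n.
  rewrite exprVn invf_plt ?posrE//; apply: (@lt_le_trans _ _ n.+1%:R).
    by rewrite truncnS_gt// invr_ge0 ltW.
  by rewrite -natrX ler_nat ltnW// ltn_expl.
case: (ex_minnP exj) => j hj minj; exists j.
have tsj : t - s <= 2^-1 ^+ j.
  case: j hj minj => [|j] hj minj; first by rewrite expr0; lra.
  by rewrite leNgt; apply/negP => /minj; rewrite ltnn.
split=> //; split; first by move: hj; rewrite exprS; lra.
have r1 : 0 < 1 - rho by rewrite subr_gt0.
have t0 : 0 <= t by case/andP: t01.
have idxst : idx t j = idx s j \/ idx t j = (idx s j).+1.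
  have /andP[a b] := idx_itv j s0; have /andP[c d] := idx_itv j t0.
  have h1 : (idx s j < (idx t j).+1)%N.
    rewrite -(ltr_nat R) (le_lt_trans a)// (lt_trans _ d)// ltr_pM2r//.
  have h2 : (idx t j < (idx s j).+2)%N.
    rewrite -(ltr_nat R) (le_lt_trans c)// -[ltRHS]natr1 -ltrBlDr (le_lt_trans _ b)//.
    move: tsj; rewrite exprVn -[X in _ <= X]mul1r ler_pdivlMr// mulrBl; lra.
  move: h2; rewrite ltnS leq_eqVlt => /predU1P[->|h2]; [by right|left].
  by apply/eqP; rewrite eqn_leq -ltnS h2.
have mid : `|f (dy t j) - f (dy s j)| <= K * rho ^+ j.
  rewrite /dy; case: idxst => e.
    by rewrite e subrr normr0 mulr_ge0// exprn_ge0// ltW.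
  rewrite e; apply: fdyad; rewrite -(ltr_nat R) natrX.
  apply: (@lt_le_trans _ _ (idx t j)%:R); first by rewrite e ltr_nat.
  by have /andP[c _] := idx_itv j t0; rewrite (le_trans c)// ler_piMl// ltW.
have ht := dy_lim j t01; have hs := dy_lim j s01.
rewrite distrC in hs.
have -> : f t - f s = (f t - f (dy t j)) + (f (dy t j) - f (dy s j)) + (f (dy s j) - f s).
  by ring.
rewrite (le_trans (ler_normD _ _))// (le_trans (lerD (ler_normD _ _) hs))//.
apply: (le_trans (lerD (lerD ht mid) (lexx _))).
by rewrite le_eqVlt; apply/orP; left; apply/eqP; field; rewrite gt_eqF.
Qed.

End DyadicChaining.

(** The first factor counts the middle step and the two geometric tails of the
    chaining; the second turns the level [2^-1 ^+ j] into the distance, which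
    is larger than [T / 2] times that level. *)
Definition holder_const {R : realType} (T alpha : R) : R :=
  (1 + 2 / (1 - 2^-1 `^ alpha)) * (2 / T) `^ alpha.

(** The deterministic half of Kolmogorov's continuity criterion. *)
Lemma holder_of_dyadic {R : realType} (T alpha K : R) (f : R -> R) :
  0 < T -> 0 < alpha -> 0 <= K ->
  (forall t, 0 <= t <= T -> forall e, 0 < e ->
     exists2 d, 0 < d & forall s, 0 <= s <= T -> `|t - s| < d -> `|f t - f s| <= e) ->
  (forall j i, (i < 2 ^ j)%N ->
     `|f (T * (i.+1%:R / 2 ^+ j)) - f (T * (i%:R / 2 ^+ j))|
       <= K * (2^-1 `^ alpha) ^+ j) ->
  forall s t, 0 <= s -> s <= t -> t <= T ->
    `|f t - f s| <= holder_const T alpha * K * (t - s) `^ alpha.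
Proof.
move=> T0 a0 K0 fc fd s t s0; set rho := 2^-1 `^ alpha.
have rho0 : 0 < rho by rewrite powR_gt0.
have rho1 : rho < 1 by exact: half_powR_lt1.
have r1 : 0 < 1 - rho by rewrite subr_gt0.
rewrite le_eqVlt => /predU1P[->|st tT].
  rewrite !subrr normr0 powR0 ?gt_eqF// mulr0//.
pose F x := f (T * x).
have Fc x : 0 <= x <= 1 -> forall e, 0 < e ->
  exists2 d, 0 < d & forall s, 0 <= s <= 1 -> `|x - s| < d -> `|F x - F s| <= e.
  have scal y : 0 <= y <= 1 -> 0 <= T * y <= T.
    by move=> /andP[y0 y1]; rewrite mulr_ge0 ?(ltW T0)//= ler_piMr// ltW.
  move=> x01 e e0; have [d d0 hd] := fc _ (scal _ x01) _ e0.
  exists (d / T); first by rewrite divr_gt0.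
  move=> y y01 xy; apply: hd; first exact: scal.
  by rewrite -mulrBr normrM gtr0_norm// mulrC -ltr_pdivlMr.
have [||| j [h1 [h2 h3]]] := dyadic_chaining rho0 rho1 K0 Fc fd (s := s / T) (t := t / T).
- by rewrite divr_ge0// ltW.
- by rewrite ltr_pM2r// invr_gt0.
- by rewrite ler_pdivrMr// mul1r.
rewrite /F !(mulrC T) !divfK ?gt_eqF// in h3.
apply: (le_trans h3); rewrite /holder_const -/rho -!mulrA.
rewrite ler_wpM2l ?addr_ge0 ?divr_ge0 ?(ltW r1)// mulrCA ler_wpM2l//.
rewrite /rho -powR_mulrn ?powR_ge0// -powRrM mulrC powRrM powR_mulrn ?invr_ge0//.
rewrite -powRM ?divr_ge0 ?(ltW T0) ?subr_ge0 ?(ltW st)//.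
rewrite ge0_ler_powR ?(ltW a0)// ?nnegrE ?exprn_ge0// ?mulr_ge0 ?invr_ge0 ?subr_ge0
  ?(ltW st) ?(ltW T0)//.
apply: ltW; apply: (lt_le_trans h2); rewrite le_eqVlt; apply/orP; left; apply/eqP.
by field; rewrite gt_eqF.
Qed.

(** * Integrals along a path and domination *)

Section PathIntegral.
Context {R : realType}.
Local Notation mu := (@lebesgue_measure R).

(** One estimate for all uses of the integral equation: with [c = 0] it bounds
    increments of the drift part, with [c] a value of [g] it compares the
    integral with a rectangle. *)
Lemma Rintegral_increment (T : R) (g : R -> R) (s t c e : R) :
  {within `[0, T], continuous g} -> 0 <= s -> s <= t -> t <= T ->
  (forall u, s <= u <= t -> `|g u - c| <= e) ->
  `|\int[mu]_(u in `[0, t]) g u - \int[mu]_(u in `[0, s]) g u - (t - s) * c|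
    <= (t - s) * e.
Proof.
move=> cg s0 st tT hg.
have ig : mu.-integrable `[0, T] (EFin \o g).
  by apply: continuous_compact_integrable => //; exact: segment_compact.
have ig0t : mu.-integrable `[0, t] (EFin \o g).
  apply: integrableS ig => //; apply: subset_itvl; rewrite bnd_simp//.
have igst : mu.-integrable `]s, t] (EFin \o g).
  apply: integrableS ig0t => //; apply: subset_itvr; rewrite bnd_simp//.
have icst (k : R) : mu.-integrable `]s, t] (EFin \o (fun=> k)).
  apply/integrableP; split; first exact/measurable_EFinP/measurable_cst.
  rewrite /= integral_cst//= lebesgue_measure_itv/=.
  by case: ifP => _; rewrite ?mule0 ?ltry// -EFinD -EFinM ltry.
have mst : fine (mu `]s, t]) = t - s.
  rewrite lebesgue_measure_itv/= lte_fin; case: ltP => [//|ts].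
  by rewrite (_ : t = s) ?subrr//; apply/eqP; rewrite eq_le ts.
have -> : \int[mu]_(u in `[0, t]) g u - \int[mu]_(u in `[0, s]) g u =
  \int[mu]_(u in `]s, t]) g u.
  by apply: Rintegral_itvB => //; rewrite bnd_simp.
have -> : (t - s) * c = \int[mu]_(u in `]s, t]) (cst c u).
  by rewrite Rintegral_cst// mst mulrC.
rewrite -RintegralB//; last exact: icst.
have iB : mu.-integrable `]s, t] (EFin \o (fun u => g u - c)).
  by apply: (integrableB _ igst (icst c)).
apply: (le_trans (le_normr_Rintegral _ iB)) => //.
have -> : (t - s) * e = \int[mu]_(u in `]s, t]) (cst e u).
  by rewrite Rintegral_cst// mst mulrC.
apply: le_Rintegral => //.
- exact: (integrable_norm iB).
- exact: icst.
- by move=> u /=; rewrite in_itv/= => /andP[/ltW su ut]; apply: hg; rewrite su.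
Qed.

Lemma within_continuous_dist (T : R) (f : R -> R) : {within `[0, T], continuous f} ->
  forall t, 0 <= t <= T -> forall e, 0 < e ->
  exists2 d, 0 < d & forall s, 0 <= s <= T -> `|t - s| < d -> `|f t - f s| <= e.
Proof.
move=> /subspace_continuousP cf t t0T e e0.
have tI : `[0, T]%classic t by rewrite /= in_itv.
have := cf t tI => /cvgrPdist_le /(_ e e0).
move=> /nbhs_ballP[d /= d0 hd]; exists d => // s s0T ts.
by apply: hd => //; rewrite /= in_itv.
Qed.

Lemma within_continuous_comp_rV m (T : R) (X : R -> 'rV[R]_m) (f : 'rV[R]_m -> R) :
  {within `[0, T], continuous X} -> continuous f ->
  {within `[0, T], continuous (fun s => f (X s))}.
Proof.
move=> cX cf s; apply: (@continuous_comp (subspace `[0, T]) _ _ X f s); first exact: cX.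
exact: cf.
Qed.

Lemma within_continuous_coord m (T : R) (X : R -> 'rV[R]_m) (i : 'I_m) :
  {within `[0, T], continuous X} -> {within `[0, T], continuous (fun s => X s 0 i)}.
Proof.
move=> cX; apply: (within_continuous_comp_rV (f := fun x => x 0 i) cX).
exact: coord_continuous.
Qed.

Lemma within_continuous_bounded m (T : R) (X : R -> 'rV[R]_m) :
  {within `[0, T], continuous X} -> exists r, forall t, 0 <= t <= T -> enorm (X t) <= r.
Proof.
move=> cX.
have /compact_bounded[M [_ hM]] := continuous_compact cX (@segment_compact R 0 T).
exists (m%:R * (M + 1)) => t t0T; apply: enorm_le_const => i.
apply: (le_trans (coord_le_mxnorm _ _)).
by apply: hM; [rewrite ltrDl|exists t => //=; rewrite in_itv].
Qed.

End PathIntegral.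

Section IntegralDomination.
Context {R : realType} d (Omega : measurableType d) (mu : {measure set Omega -> \bar R}).
Local Open Scope ereal_scope.

(** The integral of a nonnegative function is a supremum over the simple
    functions below it, hence monotone also on functions that are not
    measurable, such as a supremum over uncountably many times. *)
Lemma le_integral_dominated (D : set Omega) (f g : Omega -> \bar R) :
  measurable D ->
  (forall w, 0 <= f w) -> (forall w, 0 <= g w) -> (forall w, D w -> f w <= g w) ->
  \int[mu]_(w in D) f w <= \int[mu]_(w in D) g w.
Proof.
move=> mD f0 g0 fg; rewrite (ge0_integralE _ (fun w _ => f0 w)) (ge0_integralE _ (fun w _ => g0 w)).
apply: le_ereal_sup => _ [h hf <-]; exists h => // w; apply: (le_trans (hf w)).
by apply: lee_restrict => // x Dx; exact: fg.
Qed.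

Lemma le_integral_ae_dominated (f g : Omega -> \bar R) :
  measurable_fun setT g ->
  (forall w, 0 <= f w) -> (forall w, 0 <= g w) -> {ae mu, forall w, f w <= g w} ->
  \int[mu]_w f w <= \int[mu]_w g w.
Proof.
move=> mg f0 g0 [N [mN N0 fgN]].
pose g' w := if w \in N then +oo else g w.
have g'0 w : 0 <= g' w by rewrite /g'; case: ifP.
apply: (@le_trans _ _ (\int[mu]_w g' w)).
  apply: le_integral_dominated => // w _; rewrite /g'; case: ifPn; first by rewrite leey.
  rewrite notin_setE => wN; apply: contrapT => fg; apply: wN; apply: fgN => /= h.
  exact: fg.
have mg' : measurable_fun setT g'.
  apply: measurable_fun_ifT => //.
  apply: (measurable_fun_bool true); rewrite setTI (_ : _ @^-1` _ = N)//.
  by apply/seteqP; split => w /= => [/set_mem|/mem_set].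
rewrite le_eqVlt; apply/orP; left; apply/eqP; apply: ae_eq_integral => //.
exists N; split=> // w /= h; apply: contrapT => wN; apply: h => _.
by rewrite /g' ifN// notin_setE.
Qed.

End IntegralDomination.

(** * The pathwise error estimate *)

(** The Riemann sum with [N] cells for the integral of [B t - B x] over [x] in
    [s, t]: the first order effect on the scheme of freezing the drift at the
    right endpoint. *)
Definition noise_area {R : realType} {m : nat} (N : nat) (B : R -> 'rV[R]_m) (s t : R) : 'rV[R]_m :=
  \sum_(r < N) ((t - s) / N%:R) *: (B t - B (s + r%:R * ((t - s) / N%:R))).

Section Constants.
Context {R : realType}.
Variables (m : nat) (T alpha kappa q nx0 C : R) (D : nat).

(** Bounds in terms of the Hoelder constant [K] of the noise, on the noise, the
    solution, its drift, its Hoelder constant, the sums of local defects and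
    the error divided by the mesh. They are explicit so that their polynomial
    growth in [K] can be read off; nothing depends on the partition. *)
Let L (r : R) := C * (1 + r) ^+ D.
Definition noise_radius K := m%:R * (K * T `^ alpha).
Definition path_radius K :=
  expR (2 * kappa * T) * (nx0 + T * (m%:R * L (noise_radius K) + 1)) + noise_radius K.
Definition path_drift K := L (path_radius K).
Definition path_holder K := m%:R * (path_drift K * T `^ (1 - alpha) + K).
Definition defect_coord K :=
  m%:R * (path_drift K * (K * T `^ alpha) +
    young_const alpha * (path_drift K * path_holder K * K) * (T `^ alpha) ^+ 2) +
  T * (path_drift K * path_holder K
       + path_drift K * path_holder K ^+ 2 * T `^ (2 * alpha - 1)
       + path_drift K * m%:R * path_drift K).
Definition defect_bound K := m%:R * (defect_coord K + 2 * path_drift K).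
Definition error_bound K :=
  expR (2 * (kappa / (1 - q)) * T) * (2 * T) *
    (m%:R * L (path_radius K + defect_bound K * T) * defect_bound K) + defect_bound K.
End Constants.

Section Pathwise.
Context {R : realType} {m : nat}.
Variables (T alpha kappa q C : R) (D : nat) (x0 : 'rV[R]_m).
Hypotheses (T0 : 0 < T) (a1 : 1 / 2 < alpha) (a2 : alpha < 1).
Hypotheses (kappa0 : 0 <= kappa) (q1 : q < 1) (C0 : 0 <= C).
Variables (b : 'rV[R]_m -> 'rV[R]_m) (g : 'I_m -> 'I_m -> 'rV[R]_m -> R).
Hypotheses (bosl : one_sided_lipschitz kappa b) (bg : drift_bounds C D b g).
Variables (K : R) (B X F : R -> 'rV[R]_m).
Hypotheses (K0 : 0 <= K) (B0 : B 0 = 0).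
Hypothesis BH : forall i (s t : R), 0 <= s -> s <= t -> t <= T ->
  `|B t 0 i - B s 0 i| <= K * (t - s) `^ alpha.
Hypothesis XE : forall t : R, 0 <= t <= T -> X t = x0 + F t + B t.
Hypothesis F0 : F 0 = 0.
Hypothesis FE : forall i (s t c e : R), 0 <= s -> s <= t -> t <= T ->
  (forall u, s <= u <= t -> `|b (X u) 0 i - c| <= e) ->
  `|F t 0 i - F s 0 i - (t - s) * c| <= (t - s) * e.
Hypothesis Xb : exists r : R, forall t : R, 0 <= t <= T -> enorm (X t) <= r.

Let L (r : R) := C * (1 + r) ^+ D.

Let a0 : 0 < alpha. Proof. by move: a1; lra. Qed.

Let L_ge0 r : 0 <= r -> 0 <= L r.
Proof. by move=> r0; rewrite mulr_ge0// exprn_ge0// addr_ge0. Qed.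

Let powR_le x y : 0 <= x -> x <= y -> x `^ alpha <= y `^ alpha.
Proof. by move=> x0' xy; rewrite ge0_ler_powR ?(ltW a0)// nnegrE// (le_trans x0'). Qed.

Lemma enorm_noise t : 0 <= t <= T -> enorm (B t) <= noise_radius m T alpha K.
Proof.
move=> /andP[t0 tT]; apply: enorm_le_const => i.
have := BH i (lexx 0) t0 tT; rewrite B0 mxE !subr0 => /le_trans; apply.
by rewrite ler_wpM2l// powR_le.
Qed.

Lemma drift_increment r i s t : (forall t, 0 <= t <= T -> enorm (X t) <= r) ->
  0 <= s -> s <= t -> t <= T -> `|F t 0 i - F s 0 i| <= L r * (t - s).
Proof.
move=> Xr s0 st tT; have := FE (i := i) (c := 0) (e := L r) s0 st tT.
rewrite mulr0 subr0 mulrC; apply=> u /andP[su ut]; rewrite subr0.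
have h : enorm (X u) <= r by apply: Xr; rewrite (le_trans s0)//= (le_trans ut).
by case: (bg h h i).
Qed.

Lemma path_increment r s t : (forall t, 0 <= t <= T -> enorm (X t) <= r) ->
  0 <= s -> s <= t -> t <= T ->
  enorm (X t - X s) <= m%:R * (L r * T `^ (1 - alpha) + K) * (t - s) `^ alpha.
Proof.
move=> Xr s0 st tT; have t0 := le_trans s0 st; have sT := le_trans st tT.
rewrite !XE ?t0 ?s0// -mulrA; apply: enorm_le_const => i; rewrite !mxE.
have -> : x0 0 i + F t 0 i + B t 0 i - (x0 0 i + F s 0 i + B s 0 i) =
  (F t 0 i - F s 0 i) + (B t 0 i - B s 0 i) by ring.
rewrite (le_trans (ler_normD _ _))// mulrDl lerD ?BH//.
apply: (le_trans (drift_increment i Xr s0 st tT)); rewrite -mulrA ler_wpM2l//.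
  by rewrite L_ge0// (le_trans (enorm_ge0 (X 0)))// Xr// lexx ltW.
have ts0 : 0 <= t - s by rewrite subr_ge0.
have {1}-> : t - s = (t - s) `^ (1 - alpha) * (t - s) `^ alpha.
  by rewrite -powRD subrK ?powRr1// oner_eq0.
rewrite ler_wpM2r ?powR_ge0// ge0_ler_powR// ?nnegrE ?subr_ge0 ?(ltW T0) ?(ltW a2)//.
by rewrite lerBlDr (le_trans tT)// lerDl.
Qed.

(** Grids finer than any threshold, and powers [alpha] of their steps that
    absorb a given constant. *)
Lemma small_step (t eta : R) : 0 <= t -> 0 < eta -> exists2 N : nat, (0 < N)%N & t / N%:R <= eta.
Proof.
move=> t0 e0; exists (Num.truncn (t / eta)).+1 => //.
rewrite ler_pdivrMr ?ltr0n// mulrC -ler_pdivrMr//.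
by rewrite ltW// truncnS_gt.
Qed.

Lemma small_powR (P : R) : 0 <= P ->
  exists2 eta, 0 < eta & forall x, 0 <= x <= eta -> P * x `^ alpha <= 1.
Proof.
move=> P0; exists ((P + 1)^-1 `^ (alpha^-1)).
  by rewrite powR_gt0// invr_gt0 ltr_wpDl.
move=> x /andP[x0' xe]; apply: (@le_trans _ _ (P * ((P + 1)^-1 `^ alpha^-1) `^ alpha)).
  by rewrite ler_wpM2l// powR_le.
rewrite -powRrM mulVf ?gt_eqF// powRr1 ?invr_ge0 ?addr_ge0//.
by rewrite ler_pdivrMr ?ltr_wpDl// mul1r lerDl.
Qed.

(** On a fine grid the exact solution satisfies the implicit scheme up to an
    error of norm at most 1 in the drift, so the one-sided Lipschitz condition
    bounds it like the scheme itself, by the size of the noise. The qualitative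
    bound [Xb] serves only to choose the grid. *)
Lemma enorm_path t : 0 <= t <= T ->
  enorm (X t) <= path_radius m T alpha kappa (enorm x0) C D K.
Proof.
move=> t0T; have /andP[t0 tT] := t0T; have [r Xr] := Xb.
have r0 : 0 <= r by rewrite (le_trans (enorm_ge0 (X 0)))// Xr// lexx ltW.
pose rB := noise_radius m T alpha K.
have rB0 : 0 <= rB by rewrite mulr_ge0// mulr_ge0// powR_ge0.
pose Lr := L r; have Lr0 : 0 <= Lr by exact: L_ge0.
pose H := m%:R * (Lr * T `^ (1 - alpha) + K).
have H0 : 0 <= H by rewrite mulr_ge0// addr_ge0// mulr_ge0// powR_ge0.
have [eta e0 heta] := small_powR (mulr_ge0 (mulr_ge0 (ler0n R m) Lr0) H0).
have e1 : 0 < Num.min eta (2^-1 / (kappa + 1)).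
  by rewrite lt_min e0 divr_gt0// ltr_wpDl.
have [N N0 hN] := small_step t0 e1.
have NR : (0 : R) < N%:R by rewrite ltr0n.
pose dl := t / N%:R.
have dl0 : 0 <= dl by rewrite divr_ge0.
move: hN; rewrite le_min -/dl => /andP[dle dlk].
have kd : kappa * dl <= 2^-1.
  have k1 : 0 < kappa + 1 by rewrite ltr_wpDl.
  by move: dlk; rewrite ler_pdivlMr//; apply: le_trans; rewrite mulrC ler_wpM2l// lerDl.
pose u (k : nat) := k%:R * dl.
have uS k : u k.+1 - u k = dl by rewrite /u -natr1; ring.
have uN : u N = t by rewrite /u /dl mulrC divfK ?gt_eqF.
have u_in k : (k <= N)%N -> 0 <= u k <= T.
  move=> kN; rewrite mulr_ge0//= (le_trans _ tT)// -uN ler_wpM2r// ler_nat//.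
(* The drift that makes the grid values of the solution an implicit scheme;
   the step [dl] is zero only when [t] is. *)
pose v (k : nat) : 'rV[R]_m := if dl == 0 then 0 else dl^-1 *: (F (u k.+1) - F (u k)).
pose z (k : nat) := x0 + F (u k).
pose a := m%:R * L rB + 1.
have aL0 : 0 <= m%:R * L rB by rewrite mulr_ge0// L_ge0.
have a_ge0 : 0 <= a by rewrite /a addr_ge0.
have half1 : 2^-1 < 1 :> R by lra.
have := @implicit_gronwall R m kappa 2^-1 kappa0 half1 a N u z v a_ge0.
rewrite /z uN /u mul0r F0 addr0 subr0 -/u => G.
rewrite XE// (le_trans (ler_enormD _ _))// /path_radius -/rB lerD//; last exact: enorm_noise.
apply: (@le_trans _ _ (expR (kappa / (1 - 2^-1) * t) * (enorm x0 + t * a))).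
  apply: G => [k kN|k kN|k kN|k kN].
  - by rewrite ler_wpM2r// ler_nat.
  - by rewrite (uS k).
  - rewrite (uS k) /v; case: eqP => [d0|/eqP d0].
      by rewrite /u d0 !mulr0 F0 scaler0 !addr0.
    by rewrite scalerA divff// scale1r -addrA subrKC.
  - have /andP[uk0 _] := u_in k (ltnW kN); have /andP[uk1 ukT] := u_in k.+1 kN.
    have ukk : u k <= u k.+1 by rewrite ler_wpM2r// ler_nat.
    set zz := x0 + _; set xx := X (u k.+1).
    have ez : zz = xx - B (u k.+1) by rewrite /xx XE ?uk1// addrK.
    (* The average of [b (X u)] over a step differs from the right endpoint
       value by the oscillation of [b (X u)], at most 1 by the choice of [eta]. *)
    have near_b : dl != 0 -> enorm (v k - b xx) <= 1.
      move=> d0; apply: (@le_trans _ _ (m%:R * (Lr * (H * dl `^ alpha)))); last first.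
        have -> : m%:R * (Lr * (H * dl `^ alpha)) = m%:R * Lr * H * dl `^ alpha by ring.
        by rewrite heta// dl0.
      apply: enorm_le_const => i; rewrite /v (negbTE d0) !mxE.
      have dp : 0 < dl by rewrite lt_neqAle eq_sym d0.
      rewrite -(ler_pM2l dp) -{1}(gtr0_norm dp) -normrM.
      have -> : dl * (dl^-1 * (F (u k.+1) 0 i - F (u k) 0 i) - b xx 0 i) =
        F (u k.+1) 0 i - F (u k) 0 i - dl * b xx 0 i by field.
      rewrite -(uS k); apply: FE => // w /andP[w1 w2].
      have hx : enorm xx <= r by apply: Xr; rewrite uk1.
      have wT := le_trans w2 ukT; have w0 := le_trans uk0 w1.
      have hw : enorm (X w) <= r by apply: Xr; rewrite w0.
      have [_ + _ _ _] := bg hx hw i; move/le_trans; apply; rewrite ler_wpM2l//.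
      rewrite -opprB enormN (le_trans (path_increment Xr w0 w2 ukT))// ler_wpM2l//.
      by rewrite powR_le ?subr_ge0// lerB.
    have bB : enorm (b (B (u k.+1))) <= m%:R * L rB.
      apply: enorm_le_const => i.
      have hB : enorm (B (u k.+1)) <= rB by apply: enorm_noise; rewrite uk1.
      by case: (bg hB hB i).
    have osl : dot zz (b xx) <= kappa * enorm zz ^+ 2 + enorm zz * (m%:R * L rB).
      have -> : b xx = (b xx - b (B (u k.+1))) + b (B (u k.+1)) by rewrite subrK.
      rewrite dotDr lerD//; first by rewrite ez; exact: bosl.
      by rewrite (le_trans (dot_le_enorm _ _))// ler_wpM2l// enorm_ge0.
    have [d0|d0] := eqVneq dl 0.
      rewrite /v d0 eqxx -(scale0r 0) dotZr mul0r.
      by rewrite addr_ge0 ?mulr_ge0// ?exprn_ge0// enorm_ge0.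
    have -> : v k = b xx + (v k - b xx) by rewrite addrC subrK.
    rewrite dotDr /a mulrDl mul1r addrA lerD//; first by rewrite [_ * enorm zz]mulrC.
    rewrite (le_trans (dot_le_enorm _ _))// ler_piMr ?enorm_ge0//.
    exact: near_b.
have -> : kappa / (1 - 2^-1) = 2 * kappa by field.
rewrite ler_pM ?expR_ge0 ?addr_ge0 ?enorm_ge0 ?mulr_ge0//.
  by rewrite ler_expR ler_wpM2l// mulr_ge0.
by rewrite lerD2l ler_wpM2r.
Qed.


Let beta := path_drift m T alpha kappa (enorm x0) C D K.
Let Q := path_holder m T alpha kappa (enorm x0) C D K.
Let rX := path_radius m T alpha kappa (enorm x0) C D K.

Let rX0 : 0 <= rX.
Proof. by rewrite (le_trans (enorm_ge0 (X 0)))// enorm_path// lexx ltW. Qed.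

Let beta0 : 0 <= beta. Proof. exact: L_ge0. Qed.

Let Q0 : 0 <= Q.
Proof. by rewrite mulr_ge0// addr_ge0// mulr_ge0// powR_ge0. Qed.

Let bX t y (t0T : 0 <= t <= T) (yr : enorm y <= rX) := bg (enorm_path t0T) yr.

Let X_holder s t : 0 <= s -> s <= t -> t <= T ->
  enorm (X t - X s) <= Q * (t - s) `^ alpha.
Proof. exact: path_increment enorm_path. Qed.

Let F_lip i s t : 0 <= s -> s <= t -> t <= T -> `|F t 0 i - F s 0 i| <= beta * (t - s).
Proof. exact: drift_increment enorm_path. Qed.

(** What the exact solution leaves over when inserted into a backward Euler
    step from [s] to [t]. *)
Definition defect (s t : R) : 'rV[R]_m := (t - s) *: b (X t) - (F t - F s).

Variables (h : R) (N : nat).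
Hypotheses (h0 : 0 < h) (hT : h <= T) (N0 : (0 < N)%N) (hN : (T / N%:R) `^ alpha <= h).

Let E := beta * Q + beta * Q ^+ 2 * T `^ (2 * alpha - 1) + beta * m%:R * beta.

Let E0 : 0 <= E.
Proof.
have h1 := mulr_ge0 beta0 Q0.
have h2 := mulr_ge0 (mulr_ge0 beta0 (sqr_ge0 Q)) (powR_ge0 T (2 * alpha - 1)).
exact: addr_ge0 (addr_ge0 h1 h2) (mulr_ge0 (mulr_ge0 beta0 (ler0n R m)) beta0).
Qed.

(** The drift is expanded at the right endpoint [t]: the noise enters the local
    defect linearly, through [noise_area]. *)
Lemma defect_linear s t j : 0 <= s -> s <= t -> t <= T -> t - s <= h ->
  `|defect s t 0 j - \sum_(i < m) g i j (X t) * noise_area N B s t 0 i| <= (t - s) * (h * E).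
Proof.
move=> s0 st tT th; have NR : (0 : R) < N%:R by rewrite ltr0n.
have t0T : 0 <= t <= T by rewrite (le_trans s0).
pose dl := (t - s) / N%:R; pose p (r : nat) := s + r%:R * dl.
have dl0 : 0 <= dl by rewrite divr_ge0// subr_ge0.
have Ndl : N%:R * dl = t - s by rewrite /dl mulrC divfK ?gt_eqF.
have pN : p N = t by rewrite /p Ndl subrKC.
have p0 : p 0%N = s by rewrite /p mul0r addr0.
have pS r : p r.+1 - p r = dl by rewrite /p -natr1; ring.
have sp r : s <= p r by rewrite lerDl mulr_ge0.
have pt r : (r <= N)%N -> p r <= t.
  by move=> rN; rewrite -pN lerD2l ler_wpM2r// ler_nat.
have -> : defect s t 0 j - \sum_(i < m) g i j (X t) * noise_area N B s t 0 i =
  \sum_(r < N) (dl * b (X t) 0 j - (F (p r.+1) 0 j - F (p r) 0 j) -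
    \sum_(i < m) g i j (X t) * (dl * (B t 0 i - B (p r) 0 i))).
  rewrite !sumrB sumr_const card_ord -mulr_natl mulrA Ndl /defect !mxE.
  rewrite -(big_mkord xpredT (fun r => F (p r.+1) 0 j)).
  rewrite -(big_mkord xpredT (fun r => F (p r) 0 j)) -sumrB.
  rewrite (telescope_sumr (fun r => F (p r) 0 j))// pN p0; congr (_ - _).
  rewrite exchange_big/=; apply: eq_bigr => i _; rewrite -mulr_sumr.
  by rewrite /noise_area summxE; congr (_ * _); apply: eq_bigr => r _; rewrite !mxE.
have -> : (t - s) * (h * E) = \sum_(r < N) dl * (h * E).
  by rewrite sumr_const card_ord -mulr_natl mulrA Ndl.
apply: (le_trans (ler_norm_sum _ _ _)); apply: ler_sum => r _.
have prT : p r <= T by rewrite (le_trans (pt _ (ltnW (ltn_ord r)))).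
have prS : p r.+1 <= T by rewrite (le_trans (pt _ (ltn_ord r))).
have pr0 : 0 <= p r by rewrite (le_trans s0).
have prt : p r <= t by rewrite pt// ltnW.
have pr0T : 0 <= p r <= T by rewrite pr0.
have dla : dl `^ alpha <= h.
  apply: le_trans hN; rewrite powR_le// ler_pM2r ?invr_gt0//.
  by rewrite lerBlDr (le_trans tT)// lerDl.
have tpr : t - p r <= h by apply: le_trans th; rewrite lerB.
(* The drift integral over one cell against its left endpoint rectangle. *)
have h1 : `|F (p r.+1) 0 j - F (p r) 0 j - dl * b (X (p r)) 0 j| <= dl * (beta * (Q * h)).
  rewrite -(pS r); apply: FE => //; first by rewrite -subr_ge0 pS.
  move=> u /andP[u1 u2]; have u0 := le_trans pr0 u1; have uT := le_trans u2 prS.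
  have u0T : 0 <= u <= T by rewrite u0.
  have [_ + _ _ _] := bX pr0T (enorm_path u0T) j; move/le_trans; apply.
  rewrite ler_wpM2l//; apply: (le_trans (X_holder pr0 u1 uT)); rewrite ler_wpM2l//.
  by apply: le_trans dla; rewrite powR_le ?subr_ge0// -(pS r) lerB.
(* Here [2 * alpha > 1] makes squared path increments of order [h]. *)
have hs : h `^ alpha ^+ 2 <= h * T `^ (2 * alpha - 1).
  have e : h `^ alpha ^+ 2 = h * h `^ (2 * alpha - 1).
    rewrite mulr_powRB1 ?(ltW h0)//; last by move: a0; lra.
    by rewrite mulrC powRrM powR_mulrn ?powR_ge0.
  rewrite e ler_wpM2l ?(ltW h0)// ge0_ler_powR ?nnegrE ?(ltW h0) ?(ltW T0)//.
  by move: a1; lra.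
have h2 : `|b (X (p r)) 0 j - b (X t) 0 j - \sum_(i < m) g i j (X t) * (X (p r) 0 i - X t 0 i)|
    <= h * (beta * Q ^+ 2 * T `^ (2 * alpha - 1)).
  have [_ _ _ _ hh] := bX t0T (enorm_path pr0T) j; apply: (le_trans hh).
  have -> : h * (beta * Q ^+ 2 * T `^ (2 * alpha - 1)) =
    beta * (Q ^+ 2 * (h * T `^ (2 * alpha - 1))) by ring.
  apply: ler_wpM2l => //.
  apply: (@le_trans _ _ (Q ^+ 2 * (h `^ alpha) ^+ 2)); last by rewrite ler_wpM2l ?sqr_ge0.
  have Qh : 0 <= Q * h `^ alpha by rewrite (mulr_ge0 Q0)// powR_ge0.
  rewrite -exprMn lerXn2r// ?nnegrE ?enorm_ge0//.
  rewrite -opprB enormN (le_trans (X_holder pr0 prt tT))// ler_wpM2l//.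
  by rewrite powR_le// subr_ge0.
have h3 : `|\sum_(i < m) g i j (X t) * (F t 0 i - F (p r) 0 i)| <= h * (beta * m%:R * beta).
  apply: (le_trans (ler_norm_sum _ _ _)).
  apply: (@le_trans _ _ (\sum_(i < m) beta * (beta * h))).
    apply: ler_sum => i _; rewrite normrM.
    have [_ _ gb _ _] := bX t0T (enorm_path pr0T) j.
    by rewrite ler_pM ?gb// (le_trans (F_lip i pr0 prt tT))// ler_wpM2l.
  rewrite sumr_const card_ord -mulr_natl le_eqVlt; apply/orP; left; apply/eqP; ring.
have sumX : \sum_(i < m) g i j (X t) * (X (p r) 0 i - X t 0 i) =
   - (\sum_(i < m) g i j (X t) * (F t 0 i - F (p r) 0 i)) -
     \sum_(i < m) g i j (X t) * (B t 0 i - B (p r) 0 i).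
  rewrite -opprD -big_split -sumrN; apply: eq_bigr => i _ /=.
  by rewrite !XE// !mxE; ring.
have sumB : \sum_(i < m) g i j (X t) * (dl * (B t 0 i - B (p r) 0 i)) =
   dl * \sum_(i < m) g i j (X t) * (B t 0 i - B (p r) 0 i).
  by rewrite mulr_sumr; apply: eq_bigr => i _; ring.
rewrite sumX in h2; rewrite sumB.
move: h1 h2 h3; set Fr := F _ 0 j - F _ 0 j; set br := b (X (p r)) 0 j.
set bt := b (X t) 0 j; set SF := \sum_(i < m) _ * (F _ _ _ - _); set SB := \sum_(i < m) _.
move=> h1 h2 h3.
have -> : dl * bt - Fr - dl * SB =
   - (Fr - dl * br) - dl * (br - bt - (- SF - SB)) + dl * SF by ring.
have -> : dl * (h * E) = dl * (beta * (Q * h)) +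
    dl * (h * (beta * Q ^+ 2 * T `^ (2 * alpha - 1))) + dl * (h * (beta * m%:R * beta)).
  by rewrite /E; ring.
rewrite (le_trans (ler_normD _ _))// lerD//.
  rewrite (le_trans (ler_normB _ _))// normrN lerD//.
  by rewrite normrM ger0_norm// ler_wpM2l.
by rewrite normrM ger0_norm// ler_wpM2l.
Qed.

Variables (n : nat) (t : nat -> R).
Hypotheses (t0 : t 0%N = 0) (tn : t n = T).
Hypothesis tS : forall k, (k < n)%N -> t k <= t k.+1.
Hypothesis th : forall k, (k < n)%N -> t k.+1 - t k <= h.
Hypothesis ZH : forall i p l, (p <= l <= n)%N ->
  `|\sum_(p <= k < l) noise_area N B (t k) (t k.+1) 0 i| <= K * h * (t l - t p) `^ alpha.

Let t_mono k l : (k <= l <= n)%N -> t k <= t l.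
Proof. exact: nondecreasing_steps. Qed.

Let t_in k : (k <= n)%N -> 0 <= t k <= T.
Proof. by move=> kn; rewrite -{1}t0 -tn !t_mono ?leqnn ?kn. Qed.

Definition defects (l : nat) : 'rV[R]_m := \sum_(k < l) defect (t k) (t k.+1).

(** A weighted sum of the increments of the auxiliary noise: a discrete Young
    integral, of order [h] because that noise is. *)
Lemma defects_le l j : (l <= n)%N ->
  `|defects l 0 j| <= h * defect_coord m T alpha kappa (enorm x0) C D K.
Proof.
move=> ln; rewrite /defects summxE.
pose lin (k : nat) := \sum_(i < m) g i j (X (t k.+1)) * noise_area N B (t k) (t k.+1) 0 i.
rewrite (eq_bigr (fun k : 'I_l => lin k + (defect (t k) (t k.+1) 0 j - lin k))); last first.
  by move=> k _; rewrite addrC subrK.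
rewrite big_split/= /defect_coord -/beta -/Q mulrDr.
have tl := t_in ln; have /andP[tl0 tlT] := tl.
rewrite (le_trans (ler_normD _ _))// lerD//; last first.
  apply: (@le_trans _ _ (\sum_(k < l) (t k.+1 - t k) * (h * E))).
    apply: (le_trans (ler_norm_sum _ _ _)); apply: ler_sum => k _.
    have kn : (k < n)%N by exact: leq_trans (ltn_ord k) ln.
    have /andP[? _] := t_in (ltnW kn); have /andP[_ ?] := t_in kn.
    by apply: defect_linear; rewrite ?tS ?th.
  rewrite -mulr_suml -(big_mkord xpredT (fun k => t k.+1 - t k)) telescope_sumr// t0 subr0.
  by rewrite mulrCA ler_wpM2l ?(ltW h0)// ler_wpM2r.
rewrite exchange_big/=; apply: (le_trans (ler_norm_sum _ _ _)).
rewrite mulrCA mulr_natl -[X in _ *+ X](card_ord m) -sumr_const.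
apply: ler_sum => i _.
pose M (p : nat) := \sum_(k < p) noise_area N B (t k) (t k.+1) 0 i.
have MB p u : (p <= u)%N -> M u - M p = \sum_(p <= k < u) noise_area N B (t k) (t k.+1) 0 i.
  move=> pq; rewrite /M -!(big_mkord xpredT (fun k => noise_area N B (t k) (t k.+1) 0 i)).
  by rewrite (big_cat_nat (leq0n p) pq)/= addrAC subrr add0r.
have Kh : 0 <= K * h by rewrite mulr_ge0// ltW.
have hM p u : (p <= u <= n)%N -> `|M u - M p| <= K * h * (t u - t p) `^ alpha.
  by move=> pqn; rewrite MB ?ZH//; case/andP: pqn.
have hG p u : (p <= u <= n)%N ->
   `|g i j (X (t u)) - g i j (X (t p))| <= beta * Q * (t u - t p) `^ alpha.
  move=> pqn; have pq := t_mono pqn; case/andP: pqn => pq' qn.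
  have tp := t_in (leq_trans pq' qn); have tq := t_in qn.
  have [_ _ _ + _] := bX tp (enorm_path tq) j; move=> /(_ i) /le_trans; apply.
  rewrite -[leRHS]mulrA; apply: ler_wpM2l => //.
  by apply: X_holder => //; [case/andP: tp|case/andP: tq].
have bQ : 0 <= beta * Q by rewrite mulr_ge0.
have := discrete_young (sqr_half_powR a1) a0 bQ Kh t_mono hG hM (k := 0%N) (l := l).
rewrite leq0n ln => /(_ isT); rewrite t0 subr0 big_mkord => Yg.
under eq_bigr => k _.
  have -> : noise_area N B (t k) (t k.+1) 0 i = M k.+1 - M k by rewrite MB// big_nat1.
  over.
have gl : `|g i j (X (t l)) * (M l - M 0%N)| <= beta * (K * h * T `^ alpha).
  rewrite normrM ler_pM//; first by case: (bX tl (enorm_path tl) j).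
  have := hM 0%N l; rewrite leq0n ln => /(_ isT) /le_trans; apply.
  by rewrite t0 subr0 ler_wpM2l// powR_le.
have y0 : 0 <= young_const alpha.
  by rewrite divr_ge0// subr_ge0 ltW// sqr_half_powR.
have tlT2 : (t l `^ alpha) ^+ 2 <= (T `^ alpha) ^+ 2.
  by rewrite lerXn2r ?nnegrE ?powR_ge0// powR_le.
have {}Yg := le_trans Yg (ler_wpM2l (mulr_ge0 y0 (mulr_ge0 bQ Kh)) tlT2).
rewrite -[X in `|X|](subrK (g i j (X (t l)) * (M l - M 0%N))).
rewrite (le_trans (ler_normD _ _))// (le_trans (lerD Yg gl))//.
by rewrite le_eqVlt; apply/orP; left; apply/eqP; ring.
Qed.

Variable Y : R -> 'rV[R]_m.
Hypothesis Y0 : Y 0 = x0.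
Hypothesis YE : forall k s, (k < n)%N -> t k < s -> s <= t k.+1 ->
  Y s = Y (t k) + (s - t k) *: b (Y s) + (B s - B (t k)).
Hypothesis khq : kappa * h <= q.

Let Sb := defect_bound m T alpha kappa (enorm x0) C D K.

(** [Y - X] minus the accumulated defects follows an implicit scheme whose
    drift satisfies the one-sided Lipschitz condition up to the increment of
    [b] over the defects, of order [h]. *)
Lemma pathwise_error s : 0 <= s <= T ->
  enorm (Y s - X s) <= h * error_bound m T alpha kappa q (enorm x0) C D K.
Proof.
have Sc0 : 0 <= defect_coord m T alpha kappa (enorm x0) C D K.
  have y0 : 0 <= young_const alpha.
    by rewrite divr_ge0// subr_ge0 ltW// sqr_half_powR.
  have h1 := mulr_ge0 beta0 (mulr_ge0 K0 (powR_ge0 T alpha)).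
  have h2 := mulr_ge0 (mulr_ge0 y0 (mulr_ge0 (mulr_ge0 beta0 Q0) K0)) (sqr_ge0 (T `^ alpha)).
  exact: addr_ge0 (mulr_ge0 (ler0n R m) (addr_ge0 h1 h2)) (mulr_ge0 (ltW T0) E0).
have Sb0 : 0 <= Sb by rewrite mulr_ge0// addr_ge0// mulr_ge0.
pose a := m%:R * (L (rX + Sb * T) * (h * Sb)).
have LS0 : 0 <= L (rX + Sb * T) by rewrite L_ge0// addr_ge0// mulr_ge0// ltW.
have hSb0 : 0 <= h * Sb by rewrite (mulr_ge0 (ltW h0)).
have ag0 : 0 <= a by exact: mulr_ge0 (ler0n R m) (mulr_ge0 LS0 hSb0).
pose c := kappa / (1 - q).
have c0 : 0 <= c by rewrite divr_ge0// subr_ge0 ltW.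
have monot x S z : z = Y x - X x - S -> 0 <= x <= T -> enorm S <= h * Sb ->
  dot z (b (Y x) - b (X x)) <= kappa * enorm z ^+ 2 + a * enorm z.
  move=> ez x0T hS.
  have -> : b (Y x) - b (X x) = (b (Y x) - b (X x + S)) + (b (X x + S) - b (X x)).
    by rewrite subrKA.
  rewrite dotDr lerD//.
    have -> : z = Y x - (X x + S) by rewrite ez opprD addrA.
    exact: bosl.
  rewrite (le_trans (dot_le_enorm _ _))// mulrC ler_wpM2r ?enorm_ge0//.
  apply: enorm_le_const => j; rewrite !mxE.
  have hx : enorm (X x) <= rX + Sb * T.
    by rewrite (le_trans (enorm_path x0T))// lerDl mulr_ge0// ltW.
  have hxS : enorm (X x + S) <= rX + Sb * T.
    rewrite (le_trans (ler_enormD _ _))// lerD ?enorm_path//.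
    by rewrite (le_trans hS)// mulrC ler_wpM2l.
  have [_ + _ _ _] := bg hx hxS j; move/le_trans; apply.
  by rewrite ler_wpM2l// addrAC subrr add0r.
have hSb : forall S : 'rV[R]_m, (forall j,
    `|S 0 j| <= h * (defect_coord m T alpha kappa (enorm x0) C D K + 2 * beta)) ->
    enorm S <= h * Sb.
  by move=> S hS; rewrite mulrCA; exact: enorm_le_const.
have hdef l : (l <= n)%N -> enorm (defects l) <= h * Sb.
  move=> ln; apply: hSb => j; rewrite (le_trans (defects_le j ln))//.
  by rewrite ler_wpM2l ?(ltW h0)// lerDl mulr_ge0.
have step x k : (k < n)%N -> t k < x -> x <= t k.+1 ->
  Y x - X x - (defects k + defect (t k) x) =
  Y (t k) - X (t k) - defects k + (x - t k) *: (b (Y x) - b (X x)).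
  move=> kn kx xk.
  have x0T : 0 <= x <= T.
    have /andP[? _] := t_in (ltnW kn); have /andP[_ ?] := t_in kn.
    by apply/andP; split; [exact: le_trans (ltW kx)|exact: le_trans xk _].
  rewrite {1}(YE kn kx xk) /defect XE// (XE (t_in (ltnW kn))) scalerBr.
  by apply/rowP => j; rewrite !mxE; ring.
have defectsS k : defects k.+1 = defects k + defect (t k) (t k.+1).
  by rewrite /defects big_ord_recr.
have B00 : X 0 = x0 by rewrite XE ?F0 ?B0 ?addr0// lexx ltW.
have grid k : (k <= n)%N ->
  enorm (Y (t k) - X (t k) - defects k) <= expR (c * T) * (T * a).
  move=> kn; have := @implicit_gronwall R m kappa q kappa0 q1 a k t
    (fun k => Y (t k) - X (t k) - defects k)
    (fun k => if t k.+1 == t k then 0 else b (Y (t k.+1)) - b (X (t k.+1))) ag0.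
  rewrite t0 subr0 Y0 B00 subrr /defects big_ord0 subrr enorm0 add0r.
  have /andP[tk0 tkT] := t_in kn.
  move=> G; apply: (le_trans (G _ _ _ _)) => [p pk|p pk|p pk|p pk|].
  - by rewrite tS// (leq_trans pk).
  - by rewrite (le_trans _ khq)// ler_wpM2l// th// (leq_trans pk).
  - have pn := leq_trans pk kn.
    rewrite -!/(defects _) defectsS; case: eqP => [e|/eqP e].
      by rewrite e /defect !subrr !scale0r subr0 !addr0.
    by rewrite step// lt_neqAle tS// eq_sym e.
  - have pn := leq_trans pk kn; case: eqP => [e|/eqP e].
      rewrite -(scale0r 0) dotZr mul0r.
      exact: addr_ge0 (mulr_ge0 kappa0 (sqr_ge0 _)) (mulr_ge0 ag0 (enorm_ge0 _)).
    by apply: monot (erefl _) _ _; rewrite ?t_in// hdef.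
  - apply: ler_pM; [exact: expR_ge0|exact: mulr_ge0| |exact: ler_wpM2r].
    by rewrite ler_expR; exact: ler_wpM2l.
have fin x : enorm x <= expR (2 * c * T) * (2 * T * a) + h * Sb ->
   enorm x <= h * error_bound m T alpha kappa q (enorm x0) C D K.
  move=> /le_trans; apply; rewrite /error_bound -/c -/Sb -/rX /a /L.
  by rewrite le_eqVlt; apply/orP; left; apply/eqP; ring.
move=> /andP[s0 sT].
have [->|sn0] := eqVneq s 0.
  apply: fin; rewrite Y0 B00 subrr enorm0.
  exact: addr_ge0 (mulr_ge0 (expR_ge0 _) (mulr_ge0 (mulr_ge0 (ler0n R 2) (ltW T0)) ag0)) hSb0.
have exk : exists k, s <= t k by exists n; rewrite tn.
case: (ex_minnP exk) => -[|k] sk mink.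
  by move: sn0; rewrite eq_le s0 andbT; move: sk; rewrite t0 => ->.
have kn : (k < n)%N by apply: mink; rewrite tn.
have ks : t k < s by rewrite ltNge; apply/negP => /mink; rewrite ltnn.
apply: fin; have /andP[tk0 tkT] := t_in (ltnW kn); have s0T : 0 <= s <= T by rewrite s0.
have sk0 : 0 <= s - t k by rewrite subr_ge0 ltW.
have skh : s - t k <= h by rewrite (le_trans _ (th kn))// lerB.
have hSs : enorm (defects k + defect (t k) s) <= h * Sb.
  apply: hSb => j; rewrite mxE (le_trans (ler_normD _ _))// [leRHS]mulrDr.
  apply: lerD; first exact: defects_le (ltnW kn).
  have d1 : `|(s - t k) * b (X s) 0 j| <= h * beta.
    by rewrite normrM ger0_norm//; apply: ler_pM => //; case: (bX s0T (enorm_path s0T) j).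
  have d2 : `|F s 0 j - F (t k) 0 j| <= h * beta.
    apply: (le_trans (F_lip j tk0 (ltW ks) sT)); rewrite mulrC.
    exact: ler_wpM2r.
  rewrite /defect !mxE; apply: (le_trans (ler_normB _ _)).
  by apply: (le_trans (lerD d1 d2)); rewrite le_eqVlt; apply/orP; left; apply/eqP; ring.
have khq' : kappa * (s - t k) <= q by rewrite (le_trans _ khq)// ler_wpM2l.
have := implicit_step kappa0 q1 ag0 sk0 khq' (step _ _ kn ks sk) (monot _ _ _ (erefl _) s0T hSs).
rewrite -/c => hz.
rewrite -[X in enorm X](subrK (defects k + defect (t k) s)).
rewrite (le_trans (ler_enormD _ _))// lerD//; apply: (le_trans hz).
have -> : 2 * c * T = c * T + c * T by ring.
rewrite expRD -mulrA.
have sT' : s - t k <= T by rewrite (le_trans skh).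
apply: (@le_trans _ _ (expR (c * T) * (expR (c * T) * (T * a) + T * a))).
  apply: ler_pM; [exact: expR_ge0|exact: addr_ge0 (enorm_ge0 _) (mulr_ge0 sk0 ag0)
    |by rewrite ler_expR; exact: ler_wpM2l|].
  by rewrite lerD ?grid ?(ltnW kn)//; exact: ler_wpM2r.
rewrite ler_wpM2l ?expR_ge0//.
have -> : 2 * T * a = T * a + T * a by ring.
have Ta := mulr_ge0 (ltW T0) ag0.
have e1 : 1 <= expR (c * T) by rewrite -[leLHS]expR0 ler_expR mulr_ge0// ltW.
by rewrite mulrDr lerD2l; exact: ler_peMl.
Qed.

End Pathwise.

(** * Polynomial dependence on the Hoelder constant *)

(** The class of functions of [K >= 0] that stay integrable when a random
    variable with enough moments is substituted for [K]. *)
Definition poly_bounded {R : realType} (f : R -> R) : Prop :=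
  exists (C : R) (n : nat), 0 <= C /\
    forall K, 0 <= K -> 0 <= f K <= C * (1 + K) ^+ n.

Section PolyBounded.
Context {R : realType}.
Implicit Types (f g : R -> R) (c : R).

Lemma poly_bounded_cst c : 0 <= c -> poly_bounded (fun=> c).
Proof. by move=> c0; exists c, 0%N; split=> // K K0; rewrite expr0 mulr1 c0 lexx. Qed.

Lemma poly_bounded_id : poly_bounded (@id R).
Proof.
by exists 1, 1%N; split=> // K K0; rewrite K0 mul1r expr1 lerDr ler01.
Qed.

Lemma poly_boundedM f g : poly_bounded f -> poly_bounded g -> poly_bounded (fun K => f K * g K).
Proof.
move=> [C [n [C0 hf]]] [D [p [D0 hg]]]; exists (C * D), (n + p)%N.
split=> [|K K0]; first exact: mulr_ge0.
have /andP[f0 fC] := hf K K0; have /andP[g0 gC] := hg K K0.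
by rewrite mulr_ge0//= exprD mulrACA ler_pM.
Qed.

Lemma poly_boundedD f g : poly_bounded f -> poly_bounded g -> poly_bounded (fun K => f K + g K).
Proof.
move=> [C [n [C0 hf]]] [D [p [D0 hg]]]; exists (C + D), (n + p)%N.
split=> [|K K0]; first exact: addr_ge0.
have /andP[f0 fC] := hf K K0; have /andP[g0 gC] := hg K K0.
have K1 : 1 <= 1 + K by rewrite lerDl.
rewrite addr_ge0//= mulrDl lerD//.
  by apply: (le_trans fC); rewrite ler_wpM2l// ler_weXn2l// leq_addr.
by apply: (le_trans gC); rewrite ler_wpM2l// ler_weXn2l// leq_addl.
Qed.

Lemma poly_boundedX f n : poly_bounded f -> poly_bounded (fun K => f K ^+ n).
Proof.
move=> hf; elim: n => [|n IH].
  by have := poly_bounded_cst (@ler01 R).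
by have := poly_boundedM hf IH; congr poly_bounded; apply/funext => K; rewrite exprS.
Qed.

Lemma poly_bounded_error_bound (m : nat) (T alpha kappa q nx0 C : R) (D : nat) :
  0 <= T -> 1 / 2 < alpha -> 0 <= kappa -> q < 1 -> 0 <= nx0 -> 0 <= C ->
  poly_bounded (error_bound m T alpha kappa q nx0 C D).
Proof.
move=> T0 a1 k0 q1 x0 C0.
have y0 : 0 <= young_const alpha by rewrite divr_ge0// subr_ge0 ltW// sqr_half_powR.
have cst := poly_bounded_cst; have c1 := cst _ (@ler01 R).
have id' := poly_bounded_id.
have nat0 := ler0n R; have pw := @powR_ge0 R; have ex := @expR_ge0 R.
pose L (r : R) := C * (1 + r) ^+ D.
have pL f : poly_bounded f -> poly_bounded (fun K => L (f K)).
  by move=> hf; apply: poly_boundedM; [exact: cst|apply: poly_boundedX; exact: poly_boundedD].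
have p1 : poly_bounded (noise_radius m T alpha).
  by apply: poly_boundedM; [exact: cst|apply: poly_boundedM => //; exact: cst].
have p2 : poly_bounded (path_radius m T alpha kappa nx0 C D).
  apply: poly_boundedD => //; apply: poly_boundedM; first exact: cst.
  apply: poly_boundedD; first exact: cst.
  apply: poly_boundedM; first exact: cst.
  by apply: poly_boundedD => //; apply: poly_boundedM; [exact: cst|exact: pL].
have p3 : poly_bounded (path_drift m T alpha kappa nx0 C D) by exact: pL.
have p4 : poly_bounded (path_holder m T alpha kappa nx0 C D).
  apply: poly_boundedM; first exact: cst.
  by apply: poly_boundedD => //; apply: poly_boundedM => //; exact: cst.
have p5 : poly_bounded (defect_coord m T alpha kappa nx0 C D).
  apply: poly_boundedD.
    apply: poly_boundedM; first exact: cst.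
    apply: poly_boundedD.
      by apply: poly_boundedM => //; apply: poly_boundedM => //; exact: cst.
    apply: poly_boundedM; last by apply: cst; rewrite exprn_ge0.
    by apply: poly_boundedM; [exact: cst|apply: poly_boundedM => //; exact: poly_boundedM].
  apply: poly_boundedM; first exact: cst.
  apply: poly_boundedD; last by apply: poly_boundedM => //; apply: poly_boundedM => //; exact: cst.
  apply: poly_boundedD; first exact: poly_boundedM.
  by apply: poly_boundedM; [apply: poly_boundedM => //; exact: poly_boundedX|exact: cst].
have p6 : poly_bounded (defect_bound m T alpha kappa nx0 C D).
  apply: poly_boundedM; first exact: cst.
  by apply: poly_boundedD => //; apply: poly_boundedM => //; exact: cst.
apply: poly_boundedD => //; apply: poly_boundedM; first by apply: cst; rewrite !mulr_ge0.
apply: poly_boundedM => //; apply: poly_boundedM; first exact: cst.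
apply: pL.
by apply: poly_boundedD => //; apply: poly_boundedM => //; exact: cst.
Qed.

End PolyBounded.

(** * Gaussian moments *)

Section GaussianMoments.
Context {R : realType}.
Local Notation mu := (@lebesgue_measure R).

(** The density of the normal law is its Radon-Nikodym derivative, by
    uniqueness of the latter. *)
Lemma ge0_integral_normal_prob (s : R) (f : R -> \bar R) :
  measurable_fun setT f -> (forall x, 0 <= f x)%E ->
  (\int[normal_prob 0 s]_x f x = \int[mu]_x (f x * (normal_pdf 0 s x)%:E))%E.
Proof.
move=> mf f0.
rewrite -(Radon_Nikodym_SigmaFinite.change_of_variables (normal_prob_dominates 0 s) f0)//.
apply: ae_eq_integral => //.
- apply: emeasurable_funM => //; apply: (measurable_int mu).
  exact/Radon_Nikodym_SigmaFinite.f_integrable/normal_prob_dominates.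
- apply: emeasurable_funM => //; apply/measurable_EFinP; exact: measurable_normal_pdf.
- apply: ae_eqe_mul2l; apply: integral_ae_eq => //.
  + exact/Radon_Nikodym_SigmaFinite.f_integrable/normal_prob_dominates.
  + apply/measurable_EFinP; exact: measurable_normal_pdf.
  + move=> A _ mA; rewrite -Radon_Nikodym_SigmaFinite.f_integral//.
    exact: normal_prob_dominates.
Qed.

Lemma exprn_le_expR (n : nat) (y : R) : 0 <= y -> y ^+ n <= n%:R ^+ n * expR y.
Proof.
move=> y0; have [->|n0] := posnP n; first by rewrite !expr0 mul1r -[leLHS]expR0 ler_expR.
have nR : (0 : R) < n%:R by rewrite ltr0n.
have -> : expR y = expR (y / n%:R) ^+ n.
  by rewrite -expRM_natl mulrCA divff ?gt_eqF// mulr1.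
rewrite -exprMn lerXn2r ?nnegrE ?mulr_ge0 ?expR_ge0//.
rewrite -ler_pdivrMl// mulrC (le_trans _ (expR_ge1Dx _))// lerDr ler01//.
Qed.

(** Multiplying the density by [expR (3 x^2 / (8 s^2))] doubles the standard
    deviation, so this exponential has mean 2 and dominates all powers. *)
Lemma normal_pdf_widen (s x : R) : s != 0 ->
  expR (x ^+ 2 / (4 * s ^+ 2)) * normal_pdf 0 s x <= 2 * normal_pdf 0 (2 * s) x.
Proof.
move=> s0; have s20 : 2 * s != 0 by rewrite mulf_neq0.
rewrite !normal_pdfE// /normal_peak /normal_fun !subr0.
have s2 : 0 < s ^+ 2 by rewrite exprn_even_gt0.
have -> : Num.sqrt ((2 * s) ^+ 2 * pi *+ 2) = 2 * Num.sqrt (s ^+ 2 * pi *+ 2).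
  rewrite exprMn -mulrA -mulrnAr sqrtrM ?exprn_ge0// sqrtr_sqr ger0_norm//.
have p0 : 0 < Num.sqrt (s ^+ 2 * pi *+ 2).
  by rewrite sqrtr_gt0 pmulrn_lgt0// mulr_gt0// pi_gt0.
have -> : 2 * ((2 * Num.sqrt (s ^+ 2 * pi *+ 2))^-1 * expR (- x ^+ 2 / ((2 * s) ^+ 2 *+ 2))) =
  (Num.sqrt (s ^+ 2 * pi *+ 2))^-1 * expR (- x ^+ 2 / ((2 * s) ^+ 2 *+ 2)).
  by field; rewrite gt_eqF.
rewrite mulrCA ler_wpM2l ?invr_ge0 ?(ltW p0)// -expRD ler_expR.
have -> : x ^+ 2 / (4 * s ^+ 2) + - x ^+ 2 / (s ^+ 2 *+ 2) = - (x ^+ 2 / s ^+ 2) * 4^-1.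
  by field.
have -> : - x ^+ 2 / ((2 * s) ^+ 2 *+ 2) = - (x ^+ 2 / s ^+ 2) * 8^-1.
  by field.
rewrite !mulNr lerN2 ler_wpM2l ?divr_ge0 ?sqr_ge0//; lra.
Qed.

Lemma normal_peak_le (s : R) : s != 0 -> normal_peak s <= (2 * `|s|)^-1.
Proof.
move=> s0; have ns : 0 < `|s| by rewrite normr_gt0.
rewrite /normal_peak lef_pV2 ?posrE ?mulr_gt0//; last first.
  by rewrite sqrtr_gt0 pmulrn_lgt0// mulr_gt0 ?pi_gt0// exprn_even_gt0.
rewrite -[leLHS]ger0_norm ?mulr_ge0// -sqrtr_sqr ler_sqrt; last first.
  by rewrite mulrn_wge0// mulr_ge0 ?pi_ge0// sqr_ge0.
rewrite exprMn real_normK ?num_real//.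
have -> : s ^+ 2 * pi *+ 2 = 2 * pi * s ^+ 2 by rewrite -mulr_natr; ring.
by rewrite ler_wpM2r ?sqr_ge0//; have := @pi_ge2 R; lra.
Qed.

Context d (Omega : measurableType d) (P : probability Omega R).

Lemma integral_law d' (T' : measurableType d') (Z : Omega -> T')
    (nu : {measure set T' -> \bar R}) (f : T' -> \bar R) :
  measurable_fun setT Z -> (forall A, measurable A -> P (Z @^-1` A) = nu A) ->
  measurable_fun setT f -> (forall x, 0 <= f x)%E ->
  (\int[P]_w f (Z w) = \int[nu]_x f x)%E.
Proof.
move=> mZ law mf f0.
rewrite -[LHS](@ge0_integral_pushforward _ _ _ _ _ Z mZ P setT f)//.
by apply: eq_measure_integral => A mA _; rewrite -law.
Qed.

(** The law is that of a normal variable of some standard deviation [s].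
    Its density bounds [s ^+ 2] by the second moment, and domination of powers
    by an exponential bounds the higher moments by powers of [s ^+ 2]. *)
Lemma gaussian_moment (Z : Omega -> R) (v : R) (p : nat) : (0 < p)%N ->
  centered_gaussian P Z -> (\int[P]_w (Z w ^+ 2)%:E = v%:E)%E ->
  (\int[P]_w (Z w ^+ (2 * p))%:E <= (2 * (32 * p%:R * v) ^+ p)%:E)%E.
Proof.
move=> p0 [mZ [s law]] hv.
have ge0X n x : (0 <= ((x : R) ^+ (2 * n))%:E)%E.
  by rewrite lee_fin exprM exprn_ge0// sqr_ge0.
have mX n : measurable_fun setT (fun x : R => (x ^+ n)%:E).
  by apply/measurable_EFinP; exact: measurable_funX.
have v0 : 0 <= v.
  by rewrite -lee_fin -hv; apply: integral_ge0 => w _; rewrite (ge0X 1%N).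
have [s0|s0] := eqVneq s 0.
  have {}law A : measurable A -> P (Z @^-1` A) = \d_(0 : R) A.
    by move=> mA; rewrite law// s0 eqxx.
  rewrite (integral_law mZ law (mX _) (ge0X p)) integral_dirac//.
  rewrite diracT mul1e expr0n muln_eq0/= (gtn_eqF p0) lee_fin.
  by rewrite mulr_ge0// exprn_ge0// !mulr_ge0.
have {}law A : measurable A -> P (Z @^-1` A) = normal_prob 0 s A.
  by move=> mA; rewrite law// (negbTE s0).
have s2 : 0 < s ^+ 2 by rewrite exprn_even_gt0.
have sv : s ^+ 2 <= 8 * v.
  (* The density is at most [(2 |s|)^-1], so [|Z| < |s| / 2] has probability at
     most one half, and the second moment is at least half of [(s / 2) ^+ 2]. *)
  pose a := `|s| / 2; have a0 : 0 < a by rewrite divr_gt0// normr_gt0.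
  pose I := [set x : R | `|x| < a].
  have IE : I = `]- a, a[%classic.
    by apply/seteqP; split => x; rewrite /I/= in_itv/= ltr_norml.
  have mI : measurable I by rewrite IE.
  have PI : (P (Z @^-1` I) <= (2^-1)%:E)%E.
    rewrite law//; apply: (@le_trans _ _ (\int[mu]_(x in I) (cst (normal_peak s)%:E) x)%E).
      apply: ge0_le_integral => //.
      - by move=> x _; rewrite lee_fin normal_pdf_ge0.
      - by apply/measurable_EFinP/measurable_funTS; exact: measurable_normal_pdf.
      - by move=> x _; rewrite lee_fin normal_pdf_ub.
    rewrite integral_cst// IE/= lebesgue_measure_itv/= lte_fin gt0_cp//.
    rewrite -EFinD -EFinM lee_fin opprK.
    apply: (@le_trans _ _ ((2 * `|s|)^-1 * (a + a))).
      by rewrite ler_wpM2r ?normal_peak_le// addr_ge0// ltW.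
    by rewrite /a le_eqVlt; apply/orP; left; apply/eqP; field; rewrite normr_eq0.
  have mZI : measurable (Z @^-1` I) by rewrite -[X in measurable X]setTI; exact: mZ.
  have h : ((a ^+ 2 / 2)%:E <= \int[P]_w (Z w ^+ 2)%:E)%E.
    have mC := measurableC mZI; have mZ2 : measurable_fun setT (fun w => (Z w ^+ 2)%:E).
      by apply/measurable_EFinP; exact: measurable_funX.
    apply: (@le_trans _ _ (\int[P]_(w in ~` (Z @^-1` I)) (Z w ^+ 2)%:E)%E); last first.
      by apply: ge0_subset_integral => // w _; exact: (ge0X 1%N).
    apply: (@le_trans _ _ (\int[P]_(w in ~` (Z @^-1` I)) (cst (a ^+ 2)%:E) w)%E); last first.
      apply: ge0_le_integral => //.
      - by move=> w _; rewrite lee_fin sqr_ge0.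
      - exact: measurable_funTS.
      - move=> w /= /negP; rewrite -leNgt => aZ.
        by rewrite lee_fin -[leRHS]real_normK ?num_real// lerXn2r ?nnegrE ?(ltW a0).
    rewrite integral_cst//= (_ : P _ = 1 - P (Z @^-1` I))%E; last exact: probability_setC.
    rewrite EFinM.
    apply: lee_pmul => //; first by rewrite lee_fin sqr_ge0.
    move: PI; have : P (Z @^-1` I) \is a fin_num by exact: fin_num_measure.
    by move=> /fineK <-; rewrite -EFinB !lee_fin; lra.
  move: h; rewrite hv lee_fin /a exprMn real_normK ?num_real//.
  by lra.
have mpdf s' : measurable_fun setT (fun x : R => (normal_pdf 0 s' x)%:E).
  by apply/measurable_EFinP; exact: measurable_normal_pdf.
pose c := (4 * s ^+ 2) ^+ p * p%:R ^+ p.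
have c0 : 0 <= c by rewrite mulr_ge0 ?exprn_ge0// mulr_ge0// ltW.
rewrite (@integral_law _ (measurableTypeR R) Z (normal_prob 0 s) _ mZ law (mX _) (ge0X p)).
rewrite ge0_integral_normal_prob; [|exact: mX|exact: ge0X].
apply: (@le_trans _ _ (\int[mu]_x ((2 * c)%:E * (normal_pdf 0 (2 * s) x)%:E))%E).
  apply: ge0_le_integral => //.
  - by move=> x _; rewrite mule_ge0 ?ge0X// lee_fin normal_pdf_ge0.
  - by apply: emeasurable_funM; [exact: mX|exact: mpdf].
  - by apply: emeasurable_funM; [exact: measurable_cst|exact: mpdf].
  - move=> x _; rewrite -!EFinM lee_fin.
    have y0 : 0 <= x ^+ 2 / (4 * s ^+ 2) by rewrite divr_ge0 ?sqr_ge0// mulr_ge0// ltW.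
    apply: (@le_trans _ _ (c * (expR (x ^+ 2 / (4 * s ^+ 2)) * normal_pdf 0 s x))).
      rewrite mulrA ler_wpM2r ?normal_pdf_ge0//.
      have -> : x ^+ (2 * p) = (4 * s ^+ 2) ^+ p * (x ^+ 2 / (4 * s ^+ 2)) ^+ p.
        by rewrite -exprMn exprM; congr (_ ^+ _); field.
      rewrite /c -[leRHS]mulrA; apply: ler_wpM2l; last exact: exprn_le_expR.
      by rewrite exprn_ge0// mulr_ge0// ltW.
    rewrite [2 * c]mulrC -[leRHS]mulrA; apply: ler_wpM2l => //.
    exact: normal_pdf_widen.
rewrite ge0_integralZl//=; last 3 first.
- exact: mpdf.
- by move=> x _; rewrite lee_fin normal_pdf_ge0.
- by rewrite lee_fin mulr_ge0.
rewrite integral_normal_pdf mule1 lee_fin ler_wpM2l// /c -exprMn.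
have h1 : 0 <= 4 * s ^+ 2 * p%:R by rewrite mulr_ge0// mulr_ge0// ltW.
have h2 : 0 <= 32 * p%:R * v by rewrite !mulr_ge0.
by rewrite lerXn2r ?nnegrE//; have := ler_wpM2r (ler0n R p) sv; lra.
Qed.

End GaussianMoments.

(** * Moments of weighted increments of the noise *)

Section PowerConvexity.
Context {R : realType}.

Lemma powR_convex (p l u v : R) : 1 <= p -> 0 <= l <= 1 -> 0 <= u -> 0 <= v ->
  (l * u + (1 - l) * v) `^ p <= l * u `^ p + (1 - l) * v `^ p.
Proof.
move=> p1 /andP[l0 l1] u0 v0.
have := convex_powR p1 (Itv01 l0 l1) (x := u) (y := v).
by rewrite !inE/= !in_itv/= !andbT !convRE /= => /(_ u0 v0).
Qed.

(** A convex function takes larger values at the outer pair of two pairs with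
    the same sum. *)
Lemma norm_powR_four_points (p a x y b : R) : 1 <= p -> a <= x -> x <= b ->
  x + y = a + b -> `|x| `^ p + `|y| `^ p <= `|a| `^ p + `|b| `^ p.
Proof.
move=> p1 ax xb xy; have [ab|ab] := eqVneq a b.
  have -> : x = a by apply/eqP; rewrite eq_le ax ab xb.
  by have -> : y = b by lra.
have ab0 : 0 < b - a by rewrite subr_gt0 lt_neqAle ab (le_trans ax).
pose l := (b - x) / (b - a).
have l0 : 0 <= l by rewrite divr_ge0 ?subr_ge0// ltW// -subr_gt0.
have l1 : l <= 1 by rewrite ler_pdivrMr// mul1r lerB.
have hl : l * (b - a) = b - x by rewrite divfK ?gt_eqF.
have conv z z' k : 0 <= k -> k <= 1 ->
  `|k * z + (1 - k) * z'| `^ p <= k * `|z| `^ p + (1 - k) * `|z'| `^ p.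
  move=> k0 k1; apply: le_trans (powR_convex p1 _ _ _); rewrite ?k0//.
  have k1' : 0 <= 1 - k by rewrite subr_ge0.
  have p0 : 0 <= p by lra.
  have h : `|k * z + (1 - k) * z'| <= k * `|z| + (1 - k) * `|z'|.
    by rewrite (le_trans (ler_normD _ _))// !normrM (ger0_norm k0) (ger0_norm k1').
  by apply: ge0_ler_powR; rewrite ?nnegrE// addr_ge0// mulr_ge0.
have -> : x = l * a + (1 - l) * b by lra.
have -> : y = (1 - l) * a + (1 - (1 - l)) * b by lra.
apply: (le_trans (lerD (conv _ _ _ l0 l1) (conv a b (1 - l) _ _))); lra.
Qed.

End PowerConvexity.

Section L2Sums.
Context {R : realType} d (Omega : measurableType d) (P : probability Omega R).

Lemma second_moment_sum (I : finType) (Z : I -> Omega -> R) (c : I -> I -> R)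
    (a : I -> R) :
  (forall k, measurable_fun setT (Z k)) ->
  (forall k l, 'E_P[(fun w => Z k w * Z l w)%R] = (c k l)%:E)%E ->
  (\int[P]_w ((\sum_k a k * Z k w) ^+ 2)%:E = (\sum_k \sum_l a k * a l * c k l)%:E)%E.
Proof.
move=> mZ hc.
have mZZ k l : measurable_fun setT (fun w => (Z k w * Z l w)%:E).
  by apply/measurable_EFinP; exact: measurable_funM.
have int2 k : P.-integrable setT (fun w => (Z k w ^+ 2)%:E).
  apply/integrableP; split; first exact: mZZ.
  under eq_integral => w _ do rewrite abse_EFin ger0_norm ?sqr_ge0//.
  by have := hc k k; rewrite unlock/= => ->; rewrite ltry.
have intp k l : P.-integrable setT (fun w => (Z k w * Z l w)%:E).
  (* Products are integrable because the squares are. *)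
  apply: (le_integrable measurableT _ _ (integrableD measurableT (int2 k) (int2 l))) => //.
  move=> w _; rewrite /= lee_fin normrM [leRHS]ger0_norm; last first.
    by rewrite addr_ge0// sqr_ge0.
  have := sqr_ge0 (`|Z k w| - `|Z l w|); rewrite sqrrB !real_normK ?num_real//.
  have := sqr_ge0 (Z k w); have := sqr_ge0 (Z l w); lra.
transitivity (\int[P]_w (\sum_k \sum_l (a k * a l)%:E * (Z k w * Z l w)%:E))%E.
  apply: eq_integral => w _; rewrite expr2 mulr_suml -sumEFin; apply: eq_bigr => k _.
  rewrite mulr_sumr -sumEFin; apply: eq_bigr => l _; rewrite -EFinM; congr EFin; ring.
rewrite integral_sum//=; last first.
  by move=> k; apply: integrable_sum => // l _; exact: integrableZl.
rewrite -sumEFin; apply: eq_bigr => k _.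
rewrite integral_sum//=; last by move=> l; exact: integrableZl.
rewrite -sumEFin; apply: eq_bigr => l _.
by rewrite integralZl//; have := hc k l; rewrite unlock => e; rewrite [RHS]EFinM -e.
Qed.

End L2Sums.

Section FractionalIncrements.
Context {R : realType} d (Omega : measurableType d) (P : probability Omega R).
Variables (T : R) (m : nat) (H : 'I_m -> R) (B : R -> Omega -> 'rV[R]_m).
Hypotheses (hH : forall i, 1 / 2 < H i < 1) (hB : fBm P T H B).

Let cov (i : 'I_m) (t s : R) : R :=
  2^-1 * (t `^ (2 * H i) + s `^ (2 * H i) - `|t - s| `^ (2 * H i)).

Let p1 i : 1 <= 2 * H i. Proof. by have := hH i; lra. Qed.

Let mB i t : 0 <= t <= T -> measurable_fun setT (fun w => B t w 0 i).
Proof. by case: hB => pB _ _ _ t0T; apply: pB; rewrite in_itv. Qed.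

Let covE i t s : 0 <= t <= T -> 0 <= s <= T ->
  'E_P[(fun w => B t w 0 i * B s w 0 i)%R]%E = (cov i t s)%:E.
Proof.
case: hB => _ _ _ cB t0T s0T; rewrite cB ?in_itv//= eqxx.
by congr EFin; rewrite /cov mul1r.
Qed.

(** Increments of the noise over any two intervals are nonnegatively
    correlated, because [|.| `^ (2 * H)] is convex. *)
Let cov_increments_ge0 i u v u' v' : u <= v -> u' <= v' ->
  0 <= cov i v v' - cov i v u' - cov i u v' + cov i u u'.
Proof.
move=> uv uv'.
have := @norm_powR_four_points R (2 * H i) (u - v') (u - u') (v - v') (v - u') (p1 i).
have -> : u - u' + (v - v') = u - v' + (v - u') by ring.
have h1 : u - v' <= u - u' by rewrite lerB.
have h2 : u - u' <= v - u' by rewrite lerB.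
by move=> /(_ h1 h2 erefl); rewrite /cov; lra.
Qed.

Section Family.
Variables (I : finType) (i : 'I_m) (u v : I -> R).
Hypotheses (uT : forall r, 0 <= u r <= T) (vT : forall r, 0 <= v r <= T).
Hypothesis uv : forall r, u r <= v r.

(** A combination of increments is a combination of values of the noise at the
    right endpoints, with the weights [f], and at the left ones, with [- f]. *)
Let tm (j : I * bool) : R := if j.2 then v j.1 else u j.1.
Let wt (f : I -> R) (j : I * bool) : R := if j.2 then f j.1 else - f j.1.
Let gam (r r' : I) : R :=
  cov i (v r) (v r') - cov i (v r) (u r') - cov i (u r) (v r') + cov i (u r) (u r').

Let increments (f : I -> R) (w : Omega) : R :=
  \sum_r f r * (B (v r) w 0 i - B (u r) w 0 i).

Let tmT j : 0 <= tm j <= T. Proof. by rewrite /tm; case: ifP. Qed.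

Let sum_pairs (F : I * bool -> R) : \sum_j F j = \sum_r (F (r, true) + F (r, false)).
Proof.
transitivity (\sum_r \sum_(b : bool) F (r, b)).
  by rewrite pair_big/=; apply: eq_bigr => -[].
by apply: eq_bigr => r _; rewrite big_bool.
Qed.

Let incrementsE f w : increments f w = \sum_j wt f j * B (tm j) w 0 i.
Proof. by rewrite sum_pairs; apply: eq_bigr => r _; rewrite /wt /tm/=; ring. Qed.

Let gaussian_increments f : centered_gaussian P (increments f).
Proof.
case: hB => _ _ gB _.
have := gB #|{: I * bool}| (fun k => tm (enum_val k))
  (fun k => wt f (enum_val k) *: delta_mx 0 i) (fun k => _).
have tin (k : 'I_#|{: I * bool}|) : tm (enum_val k) \in `[0, T] by rewrite in_itv/= tmT.
move=> /(_ tin); congr (centered_gaussian P _); apply/funext => w.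
rewrite incrementsE (reindex (@enum_val {: I * bool} predT)) /=; last first.
  exact: onW_bij (enum_val_bij _).
apply: eq_bigr => k _; rewrite dotZl; congr (_ * _).
rewrite /dot (bigD1 i)//= big1 ?addr0; first by rewrite mxE !eqxx mul1r.
by move=> l li; rewrite mxE eqxx (negbTE li) mul0r.
Qed.

Let second_moment f :
  (\int[P]_w (increments f w ^+ 2)%:E = (\sum_r \sum_r' f r * f r' * gam r r')%:E)%E.
Proof.
under eq_integral => w _ do rewrite incrementsE.
rewrite (second_moment_sum (Z := fun j w => B (tm j) w 0 i)
  (c := fun j k => cov i (tm j) (tm k))) => [|j|j k]; last 2 first.
- exact: mB.
- exact: covE.
congr EFin; rewrite sum_pairs; apply: eq_bigr => r _.
rewrite !sum_pairs -big_split/=; apply: eq_bigr => r' _.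
by rewrite /wt /tm /gam/=; ring.
Qed.

(** Nonnegative correlation lets all weights in [0, 1] be replaced by 1 in the
    second moment. The increments then telescope, and a single increment of
    the noise remains: averaging does not make it rougher. *)
Lemma weighted_increments_moment f s t (p : nat) : (0 < p)%N ->
  (forall r, 0 <= f r <= 1) -> 0 <= s -> s <= t -> t <= T ->
  (forall w, \sum_r (B (v r) w 0 i - B (u r) w 0 i) = B t w 0 i - B s w 0 i) ->
  (\int[P]_w ((\sum_r f r * (B (v r) w 0 i - B (u r) w 0 i)) ^+ (2 * p))%:E
    <= (2 * (32 * p%:R * (t - s) `^ (2 * H i)) ^+ p)%:E)%E.
Proof.
move=> p0 f01 s0 st tT tele.
have s0T : 0 <= s <= T by rewrite s0 (le_trans st).
have t0T : 0 <= t <= T by rewrite tT (le_trans s0).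
pose V := \sum_r \sum_r' f r * f r' * gam r r'.
apply: (le_trans (gaussian_moment p0 (gaussian_increments f) (second_moment f))).
have V0 : 0 <= V.
  by rewrite -lee_fin -second_moment; apply: integral_ge0 => w _; rewrite lee_fin sqr_ge0.
suff VE : V <= (t - s) `^ (2 * H i).
  have c0 : 0 <= 32 * p%:R :> R by rewrite mulr_ge0.
  have c1 := ler_wpM2l c0 VE; have c2 := mulr_ge0 c0 V0.
  by rewrite lee_fin ler_wpM2l// lerXn2r// nnegrE// (le_trans c2).
have g0 r r' : 0 <= gam r r' by exact: cov_increments_ge0.
apply: (@le_trans _ _ (\sum_r \sum_r' 1 * 1 * gam r r')).
  apply: ler_sum => r _; apply: ler_sum => r' _; rewrite ler_wpM2r//.
  have /andP[a b] := f01 r; have /andP[a' b'] := f01 r'.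
  by rewrite ler_pM.
rewrite -lee_fin -(second_moment (fun=> 1)).
rewrite (eq_integral (fun w => ((B t w 0 i - B s w 0 i) ^+ 2)%:E)); last first.
  move=> w _; rewrite -tele /increments.
  by under eq_bigr do rewrite mul1r.
pose Z (b : bool) w := B (if b then t else s) w 0 i.
have -> : (\int[P]_w ((B t w 0 i - B s w 0 i) ^+ 2)%:E =
   \int[P]_w ((\sum_(b : bool) (if b then 1 else -1) * Z b w) ^+ 2)%:E)%E.
  by apply: eq_integral => w _; rewrite big_bool /Z/= mul1r mulN1r.
rewrite (second_moment_sum (Z := Z)
  (c := fun b b' => cov i (if b then t else s) (if b' then t else s))); last 2 first.
- by case; exact: mB.
- by move=> [] []; exact: covE.
rewrite !big_bool/= lee_fin /cov !subrr normr0 powR0; last by rewrite gt_eqF//; have := p1 i; lra.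
have ts0 : 0 <= t - s by rewrite subr_ge0.
by rewrite (distrC s t) (ger0_norm ts0); lra.
Qed.

End Family.

End FractionalIncrements.

(** * Moments of Hoelder constants *)

Section DyadicMoments.
Context {R : realType} d (Omega : measurableType d) (P : probability Omega R).

(** The left-hand sides of Kolmogorov's criterion, summed over all dyadic
    increments: a measurable random variable that controls the increments at
    every level simultaneously. *)
Definition dyadic_sum (T alpha : R) (p : nat) (Z : R -> Omega -> R) (w : Omega) : \bar R :=
  (\sum_(j <oo) \sum_(i < 2 ^ j)
     (((Z (T * (i.+1%:R / 2 ^+ j)) w - Z (T * (i%:R / 2 ^+ j)) w)
        / (2^-1 `^ alpha) ^+ j) ^+ (2 * p))%:E)%E.

Variables (T alpha h c : R) (p : nat) (Z : R -> Omega -> R).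
Hypotheses (T0 : 0 < T) (c0 : 0 <= c) (ph : 1 + 2 * p%:R * alpha < p%:R * h).
Hypothesis mZ : forall t, 0 <= t <= T -> measurable_fun setT (Z t).
Hypothesis momZ : forall s t, 0 <= s -> s <= t -> t <= T ->
  (\int[P]_w ((Z t w - Z s w) ^+ (2 * p))%:E <= (c * ((t - s) `^ h) ^+ p)%:E)%E.

Let rho : R := 2^-1 `^ alpha.
Let rho0 : 0 < rho. Proof. exact: powR_gt0. Qed.

Let term j (i : 'I_(2 ^ j)) w : R :=
  ((Z (T * (i.+1%:R / 2 ^+ j)) w - Z (T * (i%:R / 2 ^+ j)) w) / rho ^+ j) ^+ (2 * p).

Let term_ge0 j (i : 'I_(2 ^ j)) w : (0 <= (term i w)%:E)%E.
Proof. by rewrite lee_fin /term exprM exprn_ge0// sqr_ge0. Qed.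

Let dyad_in j k : (k <= 2 ^ j)%N -> 0 <= T * (k%:R / 2 ^+ j) <= T.
Proof.
move=> kj; rewrite mulr_ge0 ?divr_ge0 ?(ltW T0)//= ler_piMr ?(ltW T0)//.
by rewrite ler_pdivrMr ?exprn_gt0// mul1r -natrX ler_nat.
Qed.

Let mterm j (i : 'I_(2 ^ j)) : measurable_fun setT (fun w => (term i w)%:E).
Proof.
apply/measurable_EFinP/measurable_funX/measurable_funM => //.
by apply: measurable_funB; apply/mZ/dyad_in => //; exact: ltnW.
Qed.

Let level j w := (\sum_(i < 2 ^ j) (term i w)%:E)%E.

Let level_ge0 j w : (0 <= level j w)%E.
Proof. by apply: sume_ge0 => i _; exact: term_ge0. Qed.

Let mlevel j : measurable_fun setT (level j).
Proof. by apply: emeasurable_sum => i; exact: mterm. Qed.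

Lemma dyadic_sum_ge0 w : (0 <= dyadic_sum T alpha p Z w)%E.
Proof. by apply: nneseries_ge0 => j _ _; exact: level_ge0. Qed.

Lemma measurable_dyadic_sum : measurable_fun setT (dyadic_sum T alpha p Z).
Proof.
by apply: ge0_emeasurable_sum => [j w _ _|j _]; [exact: level_ge0|exact: mlevel].
Qed.

Lemma dyadic_increment_le w j i : (i < 2 ^ j)%N ->
  ((((Z (T * (i.+1%:R / 2 ^+ j)) w - Z (T * (i%:R / 2 ^+ j)) w)
       / (2^-1 `^ alpha) ^+ j) ^+ (2 * p))%:E
    <= dyadic_sum T alpha p Z w)%E.
Proof.
move=> ij; apply: (@le_trans _ _ (level j w)).
  rewrite /level (bigD1 (Ordinal ij))//= leeDl//.
  by apply: sume_ge0 => k _; exact: term_ge0.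
apply: (le_trans _ (nneseries_lim_ge j.+1 _)) => [|k _ _]; last exact: level_ge0.
rewrite big_nat_recr//= leeDr//.
by apply: sume_ge0 => k _; exact: level_ge0.
Qed.

Let theta : R := 2 * (2^-1 `^ h) ^+ p / rho ^+ (2 * p).

Let theta_lt1 : 0 <= theta < 1.
Proof.
have r0 : 0 < rho ^+ (2 * p) by exact: exprn_gt0.
rewrite /theta divr_ge0 ?(ltW r0) ?mulr_ge0 ?exprn_ge0 ?powR_ge0//=.
rewrite ltr_pdivrMr// mul1r.
have e0 : 0 < p%:R * h - 1 - 2 * p%:R * alpha by have := ph; lra.
have lt1 := half_powR_lt1 e0.
have -> : (2^-1 `^ h) ^+ p = rho ^+ (2 * p) * (2^-1 * 2^-1 `^ (p%:R * h - 1 - 2 * p%:R * alpha)).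
  rewrite /rho -!powR_mulrn ?powR_ge0// -!powRrM -[X in _ = _ * (X * _)]powRr1//.
  rewrite -!powRD; last 2 first.
  - by rewrite invr_eq0 pnatr_eq0 implybT.
  - by rewrite invr_eq0 pnatr_eq0 implybT.
  by congr (_ `^ _); rewrite natrM; ring.
rewrite (_ : 2 * _ = rho ^+ (2 * p) * 2^-1 `^ (p%:R * h - 1 - 2 * p%:R * alpha)); last by field.
by rewrite gtr_pMr.
Qed.

(** At level [j] there are [2 ^ j] increments, so the expected level sums are
    geometric, of ratio [theta]. *)
Definition dyadic_moment_bound : R := c * (T `^ h) ^+ p / (1 - theta).

Lemma integral_dyadic_sum :
  (\int[P]_w dyadic_sum T alpha p Z w <= dyadic_moment_bound%:E)%E.
Proof.
have /andP[t0 t1] := theta_lt1.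
have t1' : 0 < 1 - theta by rewrite subr_gt0.
have A0 : 0 <= c * (T `^ h) ^+ p by rewrite mulr_ge0// exprn_ge0// powR_ge0.
rewrite (integral_nneseries P measurableT mlevel (fun j w _ => level_ge0 j w)).
have lev j : (\int[P]_w level j w <= (c * (T `^ h) ^+ p * theta ^+ j)%:E)%E.
  rewrite (ge0_integral_sum P measurableT (@mterm j) (fun i w _ => term_ge0 i w)).
  apply: (@le_trans _ _ (\sum_(i < 2 ^ j)
     (c * (T `^ h) ^+ p * ((2^-1 `^ h) ^+ p) ^+ j / (rho ^+ (2 * p)) ^+ j)%:E)%E).
    apply: lee_sum => i _; rewrite /term.
    have rj : 0 < (rho ^+ (2 * p)) ^+ j by rewrite !exprn_gt0.
    have /andP[a0 _] := dyad_in (ltnW (ltn_ord i)).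
    have /andP[_ b1] := dyad_in (ltn_ord i).
    set a := T * (i%:R / 2 ^+ j) in a0 *; set b := T * (i.+1%:R / 2 ^+ j) in b1 *.
    have ba : b - a = T * 2^-1 ^+ j.
      by rewrite /a /b -mulrBr -mulrBl -natr1 addrAC subrr add0r mul1r exprVn.
    have ab : a <= b by rewrite -subr_ge0 ba mulr_ge0 ?(ltW T0)// exprn_ge0.
    under eq_integral => w _ do
      rewrite expr_div_n [(rho ^+ j) ^+ _]exprAC mulrC EFinM.
    rewrite ge0_integralZl//=; last 3 first.
    - apply/measurable_EFinP/measurable_funX/measurable_funB; apply: mZ; apply/andP; split => //.
      + exact: le_trans ab.
      + exact: le_trans ab _.
    - by move=> w _; rewrite lee_fin exprM exprn_ge0// sqr_ge0.
    - by rewrite lee_fin invr_ge0 ltW.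
    rewrite [X in (_ <= X%:E)%E]mulrC EFinM; apply: lee_pmul => //.
    - by rewrite lee_fin invr_ge0 ltW.
    - by apply: integral_ge0 => w _; rewrite lee_fin exprM exprn_ge0// sqr_ge0.
    apply: (le_trans (momZ a0 ab b1)); rewrite lee_fin ba powRM ?(ltW T0) ?exprn_ge0//.
    rewrite le_eqVlt; apply/orP; left; apply/eqP; rewrite exprMn mulrA; congr (_ * _).
    rewrite -[2^-1 ^+ j]powR_mulrn// powRAC powR_mulrn ?powR_ge0//.
    by rewrite exprAC.
  rewrite sumEFin sumr_const card_ord lee_fin -[_ *+ (2 ^ j)]mulr_natl natrX.
  rewrite /theta expr_div_n exprMn le_eqVlt; apply/orP; left; apply/eqP; ring.
apply: lime_le.
  by apply: is_cvg_nneseries => j _ _; apply: integral_ge0 => w _; exact: level_ge0.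
apply: nearW => n; apply: (le_trans (lee_sum _ (fun j _ => lev j))).
rewrite sumEFin lee_fin -mulr_sumr /dyadic_moment_bound ler_wpM2l//.
rewrite -[leRHS]mul1r ler_pdivlMr//.
have -> : (\sum_(0 <= j < n) theta ^+ j) * (1 - theta) = 1 - theta ^+ n.
  elim: n => [|n IH]; first by rewrite big_geq// mul0r expr0 subrr.
  by rewrite big_nat_recr//= mulrDl IH exprS; ring.
by rewrite gerBl exprn_ge0.
Qed.

End DyadicMoments.

(** * The accumulated noise of a partition *)

(** A bound on the sum bounds each of its terms, which is what the chaining
    argument asks for. *)
Lemma holder_of_dyadic_sum {R : realType} (T alpha x : R) (p : nat)
    d (O : measurableType d) (Z : R -> O -> R) (w : O) :
  0 < T -> 0 < alpha -> (0 < p)%N -> 0 <= x ->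
  (forall j i, (i < 2 ^ j)%N ->
    ((Z (T * (i.+1%:R / 2 ^+ j)) w - Z (T * (i%:R / 2 ^+ j)) w) / (2^-1 `^ alpha) ^+ j) ^+ (2 * p)
      <= x) ->
  (forall t, 0 <= t <= T -> forall e, 0 < e ->
     exists2 d, 0 < d & forall s, 0 <= s <= T -> `|t - s| < d -> `|Z t w - Z s w| <= e) ->
  forall s t, 0 <= s -> s <= t -> t <= T ->
    `|Z t w - Z s w| <= holder_const T alpha * x `^ ((2 * p)%:R^-1) * (t - s) `^ alpha.
Proof.
move=> T0 a0 p0 x0 hx cZ.
apply: (holder_of_dyadic T0 a0 (powR_ge0 _ _) cZ) => j i ij.
have rj : 0 < (2^-1 `^ alpha) ^+ j :> R by rewrite exprn_gt0// powR_gt0.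
rewrite -ler_pdivrMr// -{1}(gtr0_norm rj) -normf_div.
rewrite -(ler_pXn2r (n := 2 * p)) ?nnegrE ?powR_ge0// ?muln_gt0//.
rewrite -[leRHS]powR_mulrn ?powR_ge0// -powRrM mulVf ?powRr1//; last first.
  by rewrite pnatr_eq0 -lt0n muln_gt0.
by rewrite exprM real_normK ?num_real// -exprM; exact: hx.
Qed.

Lemma holder_continuous {R : realType} (T alpha C : R) (f : R -> R) :
  1 / 2 < alpha -> 0 <= C ->
  (forall s t, 0 <= s -> s <= t -> t <= T -> `|f t - f s| <= C * (t - s) `^ alpha) ->
  forall t, 0 <= t <= T -> forall e, 0 < e ->
     exists2 d, 0 < d & forall s, 0 <= s <= T -> `|t - s| < d -> `|f t - f s| <= e.
Proof.
move=> a1 C0 fH t /andP[t0 tT] e e0.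
have Ce : 0 <= C / e by rewrite divr_ge0// ltW.
have [eta eta0 heta] := small_powR a1 Ce.
exists eta => // s /andP[s0 sT] ts.
have key x y : 0 <= x -> x <= y -> y <= T -> `|y - x| < eta -> `|f y - f x| <= e.
  move=> x0 xy yT xye; apply: (le_trans (fH _ _ x0 xy yT)).
  have := heta (y - x); rewrite subr_ge0 xy -{1}[y - x]ger0_norm ?subr_ge0// (ltW xye).
  by move=> /(_ isT); rewrite mulrAC ler_pdivrMr// mul1r.
have [st|st] := leP s t; first exact: key.
by rewrite distrC; apply: key; rewrite ?(ltW st)// distrC.
Qed.

Section GridProcess.
Context {R : realType} (I : finType) (f u v : I -> R).

(** The integral over [0, t] of the step function equal to [f r] on the
    interval from [u r] to [v r], against [B]. *)
Definition grid_process (B : R -> R) (t : R) : R :=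
  \sum_r f r * (B (Num.min (v r) t) - B (Num.min (u r) t)).

(** The part of the cell from [u r] to [v r] inside [s, t] has the clamped
    endpoints. *)
Definition clamp (s t x : R) : R := Num.max s (Num.min x t).

Lemma grid_process_sub (B : R -> R) s t : s <= t ->
  grid_process B t - grid_process B s =
  \sum_r f r * (B (clamp s t (v r)) - B (clamp s t (u r))).
Proof.
move=> st; have E x : B (Num.min x t) - B (Num.min x s) = B (clamp s t x) - B s.
  rewrite /clamp; have [xs|sx] := leP x s.
    have xt : x <= t by exact: le_trans st.
    by rewrite !min_l// max_l// !subrr.
  by have -> : Num.max s (Num.min x t) = Num.min x t by apply: max_r; rewrite le_min (ltW sx) st.
rewrite /grid_process -sumrB; apply: eq_bigr => r _.
rewrite -mulrBr; congr (_ * _).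
have := E (v r); have := E (u r); move=> e1 e2.
rewrite [RHS](_ : _ = (B (clamp s t (v r)) - B s) - (B (clamp s t (u r)) - B s)); last by ring.
by rewrite -e1 -e2; ring.
Qed.

Lemma clamp_le s t x y : x <= y -> clamp s t x <= clamp s t y.
Proof. by move=> xy; rewrite /clamp ge_max !le_max !le_min !ge_min xy !lexx !orbT. Qed.

Lemma clamp_itv s t x : s <= t -> s <= clamp s t x <= t.
Proof. by move=> st; rewrite /clamp le_max ge_max ge_min !lexx st orbT. Qed.

Hypothesis f01 : forall r, 0 <= f r <= 1.
Hypothesis uv : forall r, u r <= v r.

Lemma grid_process_holder (T alpha K : R) (B : R -> R) : 0 <= K -> 0 <= alpha ->
  (forall s t, 0 <= s -> s <= t -> t <= T -> `|B t - B s| <= K * (t - s) `^ alpha) ->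
  exists2 C : R, 0 <= C & forall s t, 0 <= s -> s <= t -> t <= T ->
    `|grid_process B t - grid_process B s| <= C * (t - s) `^ alpha.
Proof.
move=> K0 a0 BH; exists (\sum_(r : I) K); first exact: sumr_ge0.
move=> s t s0 st tT; rewrite grid_process_sub// mulr_suml.
apply: (le_trans (ler_norm_sum _ _ _)); apply: ler_sum => r _.
have /andP[f0 f1] := f01 r; rewrite normrM (ger0_norm f0).
have mono := clamp_le s t (uv r).
have /andP[c1 _] := clamp_itv (u r) st; have /andP[_ c2] := clamp_itv (v r) st.
apply: (@le_trans _ _ (1 * `|B (clamp s t (v r)) - B (clamp s t (u r))|)).
  by rewrite ler_wpM2r.
rewrite mul1r (le_trans (BH _ _ _ mono _)) ?(le_trans s0)// ?(le_trans c2)//.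
by rewrite ler_wpM2l// ge0_ler_powR ?nnegrE ?subr_ge0// lerB.
Qed.

Lemma grid_process_moment d (Omega : measurableType d) (P : probability Omega R)
    (T : R) (m : nat) (H : 'I_m -> R) (B : R -> Omega -> 'rV[R]_m) (i : 'I_m)
    (p : nat) s t :
  (forall i, 1 / 2 < H i < 1) -> fBm P T H B -> (0 < p)%N ->
  0 <= s -> s <= t -> t <= T ->
  (forall phi : R -> R, \sum_r (phi (v r) - phi (u r)) = phi T - phi 0) ->
  (\int[P]_w ((grid_process (fun x => B x w 0 i) t
              - grid_process (fun x => B x w 0 i) s) ^+ (2 * p))%:E
    <= (2 * (32 * p%:R) ^+ p * ((t - s) `^ (2 * H i)) ^+ p)%:E)%E.
Proof.
move=> hH hB p0 s0 st tT tele.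
under eq_integral => w _ do rewrite grid_process_sub//.
have cT x : 0 <= clamp s t x <= T.
  by have /andP[c1 c2] := clamp_itv x st; rewrite (le_trans s0)//= (le_trans c2).
have := @weighted_increments_moment R d Omega P T m H B hH hB I i
  (fun r => clamp s t (u r)) (fun r => clamp s t (v r)) (fun r => cT _) (fun r => cT _)
  (fun r => clamp_le s t (uv r)) f s t p p0 f01 s0 st tT.
rewrite exprMn mulrA; apply=> w.
rewrite (tele (fun x => B (clamp s t x) w 0 i)) /clamp.
by rewrite (min_r tT) (max_r st) (min_l (le_trans s0 st)) (max_l s0).
Qed.

Lemma measurable_grid_process d (Omega : measurableType d) (T : R) (m : nat)
    (B : R -> Omega -> 'rV[R]_m) (i : 'I_m) t : process T B ->
  (forall r, 0 <= u r) -> 0 <= t <= T ->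
  measurable_fun setT (fun w => grid_process (fun x => B x w 0 i) t).
Proof.
move=> pB u0 /andP[t0 tT].
have mB x : 0 <= x -> measurable_fun setT (fun w => B (Num.min x t) w 0 i).
  by move=> x0; apply: pB; rewrite in_itv/= le_min x0 t0 ge_min tT orbT.
apply: measurable_sum => r; apply: measurable_funM => //.
by apply: measurable_funB; apply: mB => //; rewrite (le_trans (u0 r)).
Qed.

End GridProcess.

Section PartitionGrid.
Context {R : realType} (n N : nat) (t : nat -> R) (h : R).

Let dl (k : nat) : R := (t k.+1 - t k) / N%:R.
(** Each interval of the partition is cut into [N] cells. The weight samples
    [(x - t_k) / h] at the right end of each cell, and belongs to [0, 1]. *)
Definition grid_left (r : 'I_n * 'I_N) : R := t r.1 + r.2%:R * dl r.1.
Definition grid_right (r : 'I_n * 'I_N) : R := t r.1 + r.2.+1%:R * dl r.1.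
Definition grid_weight (r : 'I_n * 'I_N) : R := r.2.+1%:R * dl r.1 / h.

Hypothesis N0 : (0 < N)%N.

Let NR : (0 : R) < N%:R. Proof. by rewrite ltr0n. Qed.

Let Ndl k : t k + N%:R * dl k = t k.+1.
Proof. by rewrite /dl mulrC divfK ?gt_eqF// subrKC. Qed.

Lemma grid_telescope (phi : R -> R) :
  \sum_r (phi (grid_right r) - phi (grid_left r)) = phi (t n) - phi (t 0%N).
Proof.
rewrite -(pair_bigA _ (fun (k : 'I_n) (r : 'I_N) =>
   phi (grid_right (k, r)) - phi (grid_left (k, r)))) /=.
rewrite -(telescope_sumr (fun k => phi (t k)) (leq0n n)) big_mkord.
apply: eq_bigr => k _; rewrite /grid_right /grid_left/=.
rewrite -(big_mkord xpredT (fun r => phi (t k + r.+1%:R * dl k) - phi (t k + r%:R * dl k))).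
by rewrite (telescope_sumr (fun r => phi (t k + r%:R * dl k)))// Ndl mul0r addr0.
Qed.

Hypothesis tS : forall k, (k < n)%N -> t k <= t k.+1.

Let dl0 (k : 'I_n) : 0 <= dl k.
Proof. by rewrite divr_ge0 ?(ltW NR)// subr_ge0 tS. Qed.

Lemma grid_left_le_right (r : 'I_n * 'I_N) : grid_left r <= grid_right r.
Proof. by rewrite lerD2l ler_wpM2r// ler_nat. Qed.

Lemma grid_right_le (r : 'I_n * 'I_N) : grid_right r <= t r.1.+1.
Proof. by rewrite -Ndl lerD2l ler_wpM2r// ler_nat. Qed.

Lemma grid_left_ge (r : 'I_n * 'I_N) : t r.1 <= grid_left r.
Proof. by rewrite lerDl mulr_ge0. Qed.

Lemma grid_weight_itv (r : 'I_n * 'I_N) : 0 < h -> (forall k, (k < n)%N -> t k.+1 - t k <= h) ->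
  0 <= grid_weight r <= 1.
Proof.
move=> h0 th; apply/andP; split.
  exact: divr_ge0 (mulr_ge0 (ler0n R _) (dl0 _)) (ltW h0).
rewrite /grid_weight ler_pdivrMr// mul1r.
apply: le_trans (th _ (ltn_ord r.1)).
by rewrite -(Ndl r.1) addrAC subrr add0r ler_wpM2r// ler_nat.
Qed.

(** Summation by parts: weights that grow linearly along a row of cells
    accumulate the increments up to the end of the row. *)
Let abel (a : nat -> R) N' : \sum_(r < N') r.+1%:R * (a r.+1 - a r) = \sum_(r < N') (a N' - a r).
Proof.
elim: N' => [|k IH]; first by rewrite !big_ord0.
have c : \sum_(r < k) (a k.+1 - a k) = k%:R * (a k.+1 - a k).
  by rewrite sumr_const card_ord mulr_natl.
have e : \sum_(r < k) (a k.+1 - a r) = \sum_(r < k) (a k - a r) + k%:R * (a k.+1 - a k).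
  by rewrite -c -big_split; apply: eq_bigr => r _ /=; ring.
by rewrite !big_ord_recr/= IH e -natr1; ring.
Qed.

(** At the points of the partition the grid process, multiplied by the [h]
    that its weights are divided by, has accumulated the noise areas of the
    intervals already passed. This is why those areas are as regular in time
    as the noise itself, and of order [h]. *)
Lemma grid_process_noise_area m (B : R -> 'rV[R]_m) (i : 'I_m) l : h != 0 ->
  (forall p l, (p <= l <= n)%N -> t p <= t l) -> (l <= n)%N ->
  h * grid_process grid_weight grid_left grid_right (fun x => B x 0 i) (t l) =
  \sum_(k < l) noise_area N B (t k) (t k.+1) 0 i.
Proof.
move=> h0 tm ln; rewrite /grid_process.
rewrite -(pair_bigA _ (fun (k : 'I_n) (r : 'I_N) => grid_weight (k, r) *
  (B (Num.min (grid_right (k, r)) (t l)) 0 i - B (Num.min (grid_left (k, r)) (t l)) 0 i))) /=.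
rewrite mulr_sumr.
pose F (k : nat) := if (k < l)%N then noise_area N B (t k) (t k.+1) 0 i else 0.
rewrite (eq_bigr (fun k : 'I_n => F k)); last first.
  move=> k _; rewrite /F; case: ifPn => [kl|].
    have tkl : t k.+1 <= t l by apply: tm; rewrite kl ln.
    have mr r : Num.min (grid_right (k, r)) (t l) = grid_right (k, r).
      by apply: min_l; rewrite (le_trans (grid_right_le _)).
    have ml r : Num.min (grid_left (k, r)) (t l) = grid_left (k, r).
      by apply: min_l; rewrite (le_trans (grid_left_le_right _))// (le_trans (grid_right_le _)).
    under eq_bigr => r _ do rewrite mr ml.
    pose a (r : nat) := B (t k + r%:R * dl k) 0 i.
    rewrite (eq_bigr (fun r : 'I_N => (dl k / h) * (r.+1%:R * (a r.+1 - a r)))); last first.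
      by move=> r _; rewrite /grid_weight /a/=; ring.
    rewrite -mulr_sumr abel /noise_area summxE mulrA mulrCA mulrV ?unitfE// mulr1 mulr_sumr.
    by apply: eq_bigr => r _; rewrite !mxE /a Ndl.
  rewrite -leqNgt => lk; rewrite big1 ?mulr0// => r _.
  have tlk : t l <= t k by apply: tm; rewrite lk ltnW.
  have h1 := le_trans tlk (grid_left_ge (k, r)).
  have h2 := le_trans h1 (grid_left_le_right (k, r)).
  by rewrite !min_r// subrr mulr0.
rewrite -(big_mkord xpredT F) (big_cat_nat (leq0n l) ln)/= [X in _ + X]big1_seq ?addr0.
  by rewrite big_mkord; apply: eq_bigr => k _; rewrite /F ltn_ord.
by move=> k /andP[_]; rewrite mem_index_iota => /andP[lk _]; rewrite /F ltnNge lk.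
Qed.

End PartitionGrid.

(** * Control of the noise on a partition *)

Lemma ptime_partition {R : realType} (T : R) (tau : seq R) : 0 < T -> itv_partition 0 T tau ->
  [/\ ptime tau 0 = 0, ptime tau (size tau) = T,
      forall k, (k < size tau)%N -> ptime tau k <= ptime tau k.+1,
      forall k, (k < size tau)%N -> ptime tau k.+1 - ptime tau k <= mesh tau
    & 0 < mesh tau <= T].
Proof.
move=> T0 [/(pathP 0) pt /eqP lt].
have tn : ptime tau (size tau) = T by rewrite /ptime -last_nth.
have tS k : (k < size tau)%N -> ptime tau k < ptime tau k.+1 by exact: pt.
have tle k : (k < size tau)%N -> ptime tau k <= ptime tau k.+1 by move=> /tS/ltW.
have th k : (k < size tau)%N -> ptime tau k.+1 - ptime tau k <= mesh tau.
  move=> kn; exact: (le_bigmax _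
    (fun k : 'I_(size tau) => ptime tau k.+1 - ptime tau k) (Ordinal kn)).
have mono k l (kl : (k <= l)%N) (ln : (l <= size tau)%N) :=
  nondecreasing_steps tle (introT andP (conj kl ln)).
split=> //; apply/andP; split.
  have n0 : (0 < size tau)%N.
    by rewrite lt0n size_eq0; apply: contraTneq T0 => e; move: lt; rewrite e/= => <-; rewrite ltxx.
  by apply: lt_le_trans (th _ n0); rewrite subr_gt0 tS.
apply: bigmax_le => [|k _]; first exact: ltW.
rewrite lerBlDr (le_trans (mono _ _ (ltn_ord k) (leqnn _)))// tn lerDl.
exact: (mono 0%N _ (leq0n k) (ltnW (ltn_ord k))).
Qed.

Section NoiseControl.
Context {R : realType} d (Omega : measurableType d) (P : probability Omega R).
Variables (T : R) (m : nat) (H : 'I_m -> R) (B : R -> Omega -> 'rV[R]_m).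
Hypotheses (T0 : 0 < T) (hH : forall i, 1 / 2 < H i < 1) (hB : fBm P T H B).
Variables (alpha : R) (p : nat).
Hypotheses (a1 : 1 / 2 < alpha) (p0 : (0 < p)%N).
Hypothesis ph : forall i, 1 + 2 * p%:R * alpha < p%:R * (2 * H i).

Let c : R := 2 * (32 * p%:R) ^+ p.
Let c0 : 0 <= c. Proof. by rewrite mulr_ge0// exprn_ge0// mulr_ge0. Qed.
Let a0 : 0 < alpha. Proof. by have := a1; lra. Qed.

(** For each coordinate, one bound for the noise and one for its grid process. *)
Definition noise_moment : R :=
  \sum_(i < m) (dyadic_moment_bound T alpha (2 * H i) c p
                + dyadic_moment_bound T alpha (2 * H i) c p).

Let pB : process T B. Proof. by case: hB. Qed.

(** The covariance vanishes at time 0. *)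
Lemma fBm_start : {ae P, forall w, B 0 w = 0}.
Proof.
have t0 : (0 : R) \in `[0, T] by rewrite in_itv/= lexx ltW.
have B0 i : {ae P, forall w, B 0 w 0 i = 0}.
  have mB : measurable_fun setT (fun w => (B 0 w 0 i * B 0 w 0 i)%:E).
    by apply/measurable_EFinP/measurable_funM; exact: pB.
  have : (\int[P]_w `|(B 0 w 0 i * B 0 w 0 i)%:E| = 0)%E.
    case: hB => _ _ _ /(_ 0 0 i i t0 t0); rewrite unlock => cB.
    under eq_integral => w _ do rewrite abse_EFin ger0_norm -?expr2 ?sqr_ge0//.
    rewrite [LHS]cB !subrr normr0 powR0 ?addr0 ?subr0 ?mulr0//.
    by rewrite gt_eqF//; have := hH i; lra.
  move/(ae_eq_integral_abs P measurableT mB).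
  apply: filterS => w /(_ I) /= [] /eqP.
  by rewrite mulf_eq0 orbb => /eqP.
have : {ae P, forall w (k : nat) (km : (k < m)%N), B 0 w 0 (Ordinal km) = 0}.
  apply: ae_foralln => k; have [km|mk] := pselect (k < m)%N.
    by apply: filterS (B0 (Ordinal km)) => w e km'; rewrite (bool_irrelevance km' km).
  by apply: aeW => w km; case: (mk km).
apply: filterS => w h; apply/rowP => i; rewrite mxE.
by have := h _ (ltn_ord i); congr (_ = _); congr (B 0 w _ _); apply: val_inj.
Qed.

Variables (n N : nat) (t : nat -> R) (h : R).
Hypotheses (N0 : (0 < N)%N) (h0 : 0 < h) (t0 : t 0%N = 0) (tn : t n = T).
Hypothesis tS : forall k, (k < n)%N -> t k <= t k.+1.
Hypothesis th : forall k, (k < n)%N -> t k.+1 - t k <= h.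

Let ZB (i : 'I_m) (s : R) (w : Omega) : R := B s w 0 i.
Let ZM (i : 'I_m) (s : R) (w : Omega) : R :=
  grid_process (@grid_weight R n N t h) (@grid_left R n N t) (@grid_right R n N t)
    (fun x => B x w 0 i) s.

Let t_mono k l : (k <= l <= n)%N -> t k <= t l.
Proof. exact: nondecreasing_steps. Qed.

Let t_in k : (k <= n)%N -> 0 <= t k <= T.
Proof. by move=> kn; rewrite -{1}t0 -tn !t_mono ?leqnn ?kn. Qed.

Let fw r : 0 <= @grid_weight R n N t h r <= 1.
Proof. exact: grid_weight_itv. Qed.

Let lr r : @grid_left R n N t r <= @grid_right R n N t r.
Proof. exact: grid_left_le_right. Qed.

Let gl0 r : 0 <= @grid_left R n N t r.
Proof.
apply: le_trans (grid_left_ge N0 tS r).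
by have /andP[] := t_in (ltnW (ltn_ord r.1)).
Qed.

Let mZB i s : 0 <= s <= T -> measurable_fun setT (ZB i s).
Proof. by move=> s0T; apply: pB; rewrite in_itv. Qed.

Let mZM i s : 0 <= s <= T -> measurable_fun setT (ZM i s).
Proof. by move=> s0T; exact: measurable_grid_process pB gl0 s0T. Qed.

Let momB i s u : 0 <= s -> s <= u -> u <= T ->
  (\int[P]_w ((ZB i u w - ZB i s w) ^+ (2 * p))%:E <= (c * ((u - s) `^ (2 * H i)) ^+ p)%:E)%E.
Proof.
move=> s0 su uT.
have h1 (_ : 'I_1) : 0 <= s <= T by rewrite s0 (le_trans su).
have h2 (_ : 'I_1) : 0 <= u <= T by rewrite uT (le_trans s0).
have := @weighted_increments_moment R d Omega P T m H B hH hB 'I_1 i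
  (fun=> s) (fun=> u) h1 h2 (fun=> su) (fun=> 1) s u p p0.
rewrite exprMn mulrA => W; rewrite (eq_integral (fun w =>
   ((\sum_(r < 1) 1 * (B u w 0 i - B s w 0 i)) ^+ (2 * p))%:E)); last first.
  by move=> w _; rewrite big_ord1 mul1r.
apply: W => // [_|w]; first by rewrite ler01 lexx.
by rewrite big_ord1.
Qed.

Let momM i s u : 0 <= s -> s <= u -> u <= T ->
  (\int[P]_w ((ZM i u w - ZM i s w) ^+ (2 * p))%:E <= (c * ((u - s) `^ (2 * H i)) ^+ p)%:E)%E.
Proof.
move=> s0 su uT; apply: (grid_process_moment fw lr i hH hB p0 s0 su uT) => phi.
by rewrite grid_telescope// tn t0.
Qed.

(** Controls at once the Hoelder constants of all coordinates of the noise and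
    of its grid process. Its integral is bounded by [noise_moment], which
    does not depend on the partition. *)
Definition noise_sum (w : Omega) : \bar R :=
  (\sum_(i < m) (dyadic_sum T alpha p (ZB i) w + dyadic_sum T alpha p (ZM i) w))%E.

Lemma noise_sum_ge0 w : (0 <= noise_sum w)%E.
Proof. by apply: sume_ge0 => i _; apply: adde_ge0; exact: dyadic_sum_ge0. Qed.

Let mdB i : measurable_fun setT (dyadic_sum T alpha p (ZB i)).
Proof. by apply: measurable_dyadic_sum => // s; exact: mZB. Qed.

Let mdM i : measurable_fun setT (dyadic_sum T alpha p (ZM i)).
Proof. by apply: measurable_dyadic_sum => // s; exact: mZM. Qed.

Lemma measurable_noise_sum : measurable_fun setT noise_sum.
Proof. by apply: emeasurable_sum => i; exact: emeasurable_funD. Qed.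

Lemma integral_noise_sum : (\int[P]_w noise_sum w <= noise_moment%:E)%E.
Proof.
rewrite (ge0_integral_sum P measurableT (f := fun i w =>
  dyadic_sum T alpha p (ZB i) w + dyadic_sum T alpha p (ZM i) w)%E); last 2 first.
- by move=> i; exact: emeasurable_funD.
- by move=> i w _; apply: adde_ge0; exact: dyadic_sum_ge0.
rewrite /noise_moment -sumEFin; apply: lee_sum => i _.
rewrite ge0_integralD//; try by move=> w _; exact: dyadic_sum_ge0.
rewrite EFinD; apply: leeD.
- exact: (integral_dyadic_sum T0 c0 (ph i) (mZB i) (momB i)).
- exact: (integral_dyadic_sum T0 c0 (ph i) (mZM i) (momM i)).
Qed.

Let noise_sum_le w x i : (noise_sum w <= x%:E)%E ->
  (dyadic_sum T alpha p (ZB i) w <= x%:E)%E /\ (dyadic_sum T alpha p (ZM i) w <= x%:E)%E.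
Proof.
move=> Sx; have b0 := dyadic_sum_ge0 T alpha p (ZB i) w.
have m0 := dyadic_sum_ge0 T alpha p (ZM i) w.
have le : (dyadic_sum T alpha p (ZB i) w + dyadic_sum T alpha p (ZM i) w <= x%:E)%E.
  apply: le_trans Sx; rewrite /noise_sum (bigD1 i)//= leeDl//.
  by apply: sume_ge0 => j _; apply: adde_ge0; exact: dyadic_sum_ge0.
by split; apply: le_trans le; rewrite ?leeDl ?leeDr.
Qed.

Let K (x : R) := holder_const T alpha * x `^ ((2 * p)%:R^-1).

Lemma noise_holder w x : {within `[0, T], continuous (fun s => B s w)} ->
  0 <= x -> (noise_sum w <= x%:E)%E ->
  forall i s u, 0 <= s -> s <= u -> u <= T ->
    `|B u w 0 i - B s w 0 i| <= K x * (u - s) `^ alpha.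
Proof.
move=> cB x0 Sx i.
apply: (holder_of_dyadic_sum (Z := ZB i) T0 a0 p0 x0) => [j k kj|].
  rewrite -lee_fin; have [+ _] := noise_sum_le i Sx; apply: le_trans.
  exact: dyadic_increment_le.
apply: within_continuous_dist.
exact: within_continuous_coord.
Qed.

Lemma noise_area_holder w x : 0 <= K x -> {within `[0, T], continuous (fun s => B s w)} ->
  0 <= x -> (noise_sum w <= x%:E)%E ->
  forall i k l, (k <= l <= n)%N ->
    `|\sum_(k <= j < l) noise_area N (fun s => B s w) (t j) (t j.+1) 0 i|
      <= K x * h * (t l - t k) `^ alpha.
Proof.
move=> K0 cB x0 Sx i k l kln; have /andP[kl ln] := kln.
have kn := leq_trans kl ln.
have [C C0 gH] := grid_process_holder fw lr K0 (ltW a0) (noise_holder cB x0 Sx i).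
have gc := holder_continuous a1 C0 gH.
have gK : forall s u, 0 <= s -> s <= u -> u <= T ->
    `|ZM i u w - ZM i s w| <= K x * (u - s) `^ alpha.
  apply: (holder_of_dyadic_sum (Z := ZM i) T0 a0 p0 x0) => [j r rj|//].
  rewrite -lee_fin; have [_] := noise_sum_le i Sx; apply: le_trans.
  exact: dyadic_increment_le.
have hn : h != 0 by rewrite gt_eqF.
have el := grid_process_noise_area N0 tS (fun s => B s w) i hn t_mono ln.
have ek := grid_process_noise_area N0 tS (fun s => B s w) i hn t_mono kn.
have -> : \sum_(k <= j < l) noise_area N (fun s => B s w) (t j) (t j.+1) 0 i =
   h * (ZM i (t l) w - ZM i (t k) w).
  rewrite mulrBr /ZM el ek.
  rewrite -!(big_mkord xpredT (fun j => noise_area N (fun s => B s w) (t j) (t j.+1) 0 i)).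
  by rewrite (big_cat_nat (leq0n k) kl)/= addrAC subrr add0r.
rewrite normrM (gtr0_norm h0) [K x * h]mulrC -mulrA ler_wpM2l ?(ltW h0)//.
have /andP[tk0 _] := t_in kn; have /andP[_ tlT] := t_in ln.
by apply: gK => //; exact: t_mono.
Qed.

End NoiseControl.

(** * The rate of convergence *)

Lemma exprD1_le {R : realType} (y : R) (k : nat) : 0 <= y -> (1 + y) ^+ k <= 2 ^+ k * (1 + y ^+ k).
Proof.
move=> y0; have [y1|y1] := leP y 1.
  apply: (@le_trans _ _ (2 ^+ k)); first by rewrite lerXn2r// ?nnegrE; lra.
  by rewrite ler_peMr ?exprn_ge0// lerDl exprn_ge0.
apply: (@le_trans _ _ ((2 * y) ^+ k)); first by rewrite lerXn2r// ?nnegrE; lra.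
by rewrite exprMn ler_wpM2l ?exprn_ge0// lerDr.
Qed.

Lemma holder_const_ge0 {R : realType} (T alpha : R) : 0 < alpha -> 0 <= holder_const T alpha.
Proof.
move=> a0; have h := half_powR_lt1 a0.
by rewrite mulr_ge0 ?powR_ge0// addr_ge0// divr_ge0// subr_ge0 ltW.
Qed.

(** A Hoelder exponent above 1/2 and uniformly below all Hurst parameters. *)
Lemma exponent_below {R : realType} (m : nat) (H : 'I_m -> R) :
  (forall i, 1 / 2 < H i < 1) ->
  exists alpha e : R, [/\ 1 / 2 < alpha, alpha < 1, 0 < e & forall i, alpha + e <= H i].
Proof.
move=> hH; pose hm := \big[Num.min/1]_(i < m) H i.
have h1 : 1 / 2 < hm by apply: lt_bigmin => [|i _]; [lra|case/andP: (hH i)].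
have h2 : hm <= 1 by exact: bigmin_le_id.
have h3 i : hm <= H i by exact: bigmin_le.
by exists ((1 / 2 + hm) / 2), ((hm - 1 / 2) / 2); split; [lra|lra|lra|move=> i; have := h3 i; lra].
Qed.

Section EulerPath.
Context {R : realType} {m : nat}.
Variables (T alpha kappa q C : R) (D : nat) (x0 : 'rV[R]_m).
Hypotheses (T0 : 0 < T) (a1 : 1 / 2 < alpha) (a2 : alpha < 1).
Hypotheses (kappa0 : 0 <= kappa) (q1 : q < 1) (C0 : 0 <= C).
Variables (b : 'rV[R]_m -> 'rV[R]_m) (g : 'I_m -> 'I_m -> 'rV[R]_m -> R).
Hypotheses (cb : classC 3 b) (bosl : one_sided_lipschitz kappa b).
Hypothesis bg : drift_bounds C D b g.

(** The pathwise estimate, for a path that solves the integral equation and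
    the scheme on the partition [tau]. *)
Lemma euler_path_error (tau : seq R) (N : nat) (K : R) (B X Y : R -> 'rV[R]_m) :
  itv_partition 0 T tau -> kappa * mesh tau <= q ->
  (0 < N)%N -> (T / N%:R) `^ alpha <= mesh tau -> 0 <= K -> B 0 = 0 ->
  (forall i (s t : R), 0 <= s -> s <= t -> t <= T ->
     `|B t 0 i - B s 0 i| <= K * (t - s) `^ alpha) ->
  (forall i k l, (k <= l <= size tau)%N ->
    `|\sum_(k <= j < l) noise_area N B (ptime tau j) (ptime tau j.+1) 0 i|
      <= K * mesh tau * (ptime tau l - ptime tau k) `^ alpha) ->
  {within `[0, T], continuous X} ->
  (forall t, t \in `[0, T] -> forall i : 'I_m,
     X t 0 i = x0 0 i + (\int[lebesgue_measure]_(s in `[0, t]) (b (X s) 0 i))%R + B t 0 i) ->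
  Y 0 = x0 ->
  (forall k : nat, (k < size tau)%N ->
     forall t, t \in `]ptime tau k, ptime tau k.+1] ->
       Y t = Y (ptime tau k) + (t - ptime tau k) *: b (Y t) + (B t - B (ptime tau k))) ->
  forall t, 0 <= t <= T ->
  enorm (Y t - X t) <= mesh tau * error_bound m T alpha kappa q (enorm x0) C D K.
Proof.
move=> tauT kq N0 hN K0 B0 BH ZH cX XE Y0 YE t tT.
have [t0 tn tS th /andP[h0 hT]] := ptime_partition T0 tauT.
pose F (t : R) : 'rV[R]_m :=
  \row_i (\int[lebesgue_measure]_(s in `[0, t]) (b (X s) 0 i))%R.
have cbi i : continuous (coordf b i) by have [+ _] := cb i; move=> /(_ [::]); exact.
apply: (@pathwise_error R m T alpha kappa q C D x0 T0 a1 a2 kappa0 q1 C0 b g bosl bg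
  K B X F K0 B0 BH _ _ _ _ (mesh tau) N h0 hT N0 hN (size tau) (ptime tau)
  t0 tn tS th ZH Y Y0) => //.
- by move=> s s0T; apply/rowP => i; rewrite !mxE XE// in_itv.
- by apply/rowP => i; rewrite !mxE set_itv1 Rintegral_set1.
- move=> i s u c e s0 su uT; rewrite !mxE; apply: (Rintegral_increment (T := T)) => //.
  exact: (within_continuous_comp_rV (f := coordf b i)).
- exact: within_continuous_bounded.
- by move=> k s kn ks sk; apply: YE => //; rewrite in_itv/= ks.
Qed.

End EulerPath.

(** The [2 p]-th power of the Hoelder constant is bounded by the noise sum, so
    a polynomial of degree at most [p] in it is square integrable. *)
Lemma sqr_error_le {R : realType} (f : R -> R) (C A x : R) (n p : nat) :
  (0 < p)%N -> (n <= p)%N -> 0 <= C -> 0 <= A -> 0 <= x ->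
  (forall K, 0 <= K -> 0 <= f K <= C * (1 + K) ^+ n) ->
  f (A * x `^ ((2 * p)%:R^-1)) ^+ 2 <= C ^+ 2 * ((1 + A) * 2) ^+ (2 * p) * (1 + x).
Proof.
move=> p0 np C0 A0 x00 hf; set y := x `^ _.
have y0 : 0 <= y by exact: powR_ge0.
have yx : y ^+ (2 * p) = x.
  rewrite -powR_mulrn ?powR_ge0// -powRrM mulVf ?powRr1//.
  by rewrite pnatr_eq0 -lt0n muln_gt0.
have /andP[f0 fC] := hf _ (mulr_ge0 A0 y0).
have Ay : 0 <= A * y by exact: mulr_ge0.
have h1 : f (A * y) <= C * ((1 + A) * (1 + y)) ^+ p.
  apply: (le_trans fC); rewrite ler_wpM2l//.
  apply: (@le_trans _ _ ((1 + A * y) ^+ p)); first by rewrite ler_weXn2l// lerDl.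
  have h : 1 + A * y <= (1 + A) * (1 + y) by nra.
  by rewrite lerXn2r// nnegrE; lra.
have h2 : f (A * y) ^+ 2 <= (C * ((1 + A) * (1 + y)) ^+ p) ^+ 2.
  by rewrite lerXn2r// nnegrE// (le_trans f0).
apply: (le_trans h2); rewrite exprMn -exprM [(p * 2)%N]mulnC -[leRHS]mulrA ler_wpM2l ?sqr_ge0//.
rewrite !exprMn -mulrA ler_wpM2l ?exprn_ge0 ?addr_ge0//.
by rewrite -yx exprD1_le.
Qed.

Theorem theorem4p10 (R : realType) (T : R) (hT : 0 < T)
    (m : nat) (hm : (1 <= m)%N) (x0 : 'rV[R]_m)
    (H : 'I_m -> R) (hH : forall i, 1 / 2 < H i < 1)
    (d : measure_display) (Omega : measurableType d) (P : probability Omega R)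
    (B : R -> Omega -> 'rV[R]_m) (hB : fBm P T H B)
    (N2 : tensor R m 2 -> R) (hN2 : is_norm N2)
    (N3 : tensor R m 3 -> R) (hN3 : is_norm N3)
    (kappa mu : R) (hmu : 0 <= mu) (q : R) (hq : q < 1) :
  exists C : R,
    forall (b : 'rV[R]_m -> 'rV[R]_m) (X : R -> Omega -> 'rV[R]_m),
      classC 3 b ->
      one_sided_lipschitz kappa b ->
      poly_growth3 N2 N3 kappa mu b ->
      sde_solution P T x0 b B X ->
      forall (tau : seq R) (Y : R -> Omega -> 'rV[R]_m),
        itv_partition 0 T tau ->
        kappa * mesh tau <= q ->
        backward_euler P T x0 b B tau Y ->
        (\int[P]_w ereal_sup
           [set (enorm (Y t w - X t w) ^+ 2)%:E | t in `[0%R, T]]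
         <= (C * mesh tau ^+ 2)%:E)%E /\
        (\int[lebesgue_measure]_(t in `[0%R, T])
           \int[P]_w (enorm (Y t w - X t w) ^+ 2)%:E
         <= (C * mesh tau ^+ 2)%:E)%E.
Proof.
have [CL [D [CL0 hdrift]]] := drift_estimates N3 kappa hN2 hmu.
have [k0|k0] := leP 0 kappa; last first.
  exists 0 => b X _ _ gb; exfalso.
  have := gb 0; rewrite !ge_max => /andP[/andP[h _] _].
  have := le_trans (enorm_ge0 _) h; rewrite leNgt; apply/negP/negPn.
  by rewrite nmulr_rlt0// ltr_pwDl// powR_ge0.
have [alpha [e [a1 a2 e0 aH]]] := exponent_below hH.
have a0 : 0 < alpha by lra.
have [Ce [ne [Ce0 hE]]] :=
  poly_bounded_error_bound m D (ltW hT) a1 k0 hq (enorm_ge0 x0) CL0.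
(* The order [p] exceeds the degree of the error bound and is large enough
   for Kolmogorov's criterion with the margin [e] between exponents. *)
pose p := (maxn ne (Num.truncn ((2 * e)^-1))).+1.
have p0 : (0 < p)%N by [].
have nep : (ne <= p)%N by rewrite /p leqW// leq_maxl.
have pe : 1 < 2 * e * p%:R.
  rewrite mulrC -ltr_pdivrMr ?mulr_gt0// mul1r.
  apply: (lt_le_trans (truncnS_gt _)); rewrite ler_nat ltnS leq_maxr//.
have ph i : 1 + 2 * p%:R * alpha < p%:R * (2 * H i).
  have pR : (0 : R) <= p%:R by [].
  by have := ler_wpM2l pR (aH i); lra.
pose A := holder_const T alpha.
have A0 : 0 <= A by exact: holder_const_ge0.
pose Cf := Ce ^+ 2 * ((1 + A) * 2) ^+ (2 * p) + 1.
have Cf0 : 0 < Cf.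
  by rewrite ltr_wpDl// mulr_ge0 ?sqr_ge0// exprn_ge0// mulr_ge0// addr_ge0.
pose CS := noise_moment T H alpha p.
pose C1 := Cf * (1 + CS).
exists (C1 * (1 + T)) => b X cb ob gb sX tau Y tauT kq bY.
have [g bg] := hdrift b cb gb.
have [t0 tn tS th /andP[h0 hT']] := ptime_partition hT tauT.
set h := mesh tau in h0 hT' th kq *.
(* The number [N] of cells depends on the mesh but not on the path; its only
   requirement is that a cell has Hoelder size at most the mesh. *)
have hi0 : 0 <= h^-1 by rewrite invr_ge0 ltW.
have [eta eta0 heta] := small_powR a1 hi0.
have [N N0 Neta] := small_step (ltW hT) eta0.
have hN : (T / N%:R) `^ alpha <= h.
  have := heta (T / N%:R); rewrite Neta divr_ge0 ?(ltW hT)// => /(_ isT).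
  by rewrite mulrC ler_pdivrMr// mul1r.
pose S := noise_sum T B alpha p (size tau) N (ptime tau) h.
have S0 w : (0 <= S w)%E by exact: noise_sum_ge0.
pose gw w := ((h ^+ 2 * Cf)%:E * (1 + S w))%E.
have hC : 0 < h ^+ 2 * Cf by rewrite mulr_gt0// exprn_gt0.
have gw0 w : (0 <= gw w)%E.
  by rewrite mule_ge0// ?adde_ge0// lee_fin ltW.
have mS : measurable_fun setT S by exact: (measurable_noise_sum hT hB alpha p h N0 t0 tn tS).
have mg : measurable_fun setT gw.
  by apply: measurable_funeM; apply: emeasurable_funD.
have key : {ae P, forall w, forall t, t \in `[0, T] ->
    ((enorm (Y t w - X t w) ^+ 2)%:E <= gw w)%E}.
  have [_ sXae] := sX; have [_ bYae] := bY; have [_ cB _ _] := hB.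
  have B0 := fBm_start hT hH hB.
  apply: filterS2 (filterI cB B0) (filterI sXae bYae) => w [cBw B0w] [[cXw XEw] [Y0w YEw]] t.
  rewrite in_itv/= => tT.
  (* Where the noise sum is infinite there is nothing to prove. *)
  have [Sy|Sfin] := eqVneq (S w) +oo%E.
    by rewrite /gw Sy addey// gt0_muley ?leey// lte_fin.
  have Sf : S w \is a fin_num by rewrite ge0_fin_numE// lt_neqAle Sfin leey.
  pose x := fine (S w); have x0' : 0 <= x by exact: fine_ge0.
  have Sx : (S w <= x%:E)%E by rewrite fineK.
  pose K := A * x `^ ((2 * p)%:R^-1).
  have K0 : 0 <= K by rewrite mulr_ge0// powR_ge0.
  have BH := noise_holder hT a1 p0 cBw x0' Sx.
  have ZH := noise_area_holder hT a1 p0 N0 h0 t0 tn tS th K0 cBw x0' Sx.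
  have err := euler_path_error hT a1 a2 k0 hq CL0 cb ob bg tauT kq N0 hN K0 B0w BH ZH
    cXw XEw Y0w YEw tT.
  rewrite /gw -(fineK Sf) -/x -EFinD -EFinM lee_fin.
  have E0 : 0 <= error_bound m T alpha kappa q (enorm x0) CL D K by case/andP: (hE K K0).
  apply: (@le_trans _ _ ((h * error_bound m T alpha kappa q (enorm x0) CL D K) ^+ 2)).
    by rewrite lerXn2r// nnegrE ?enorm_ge0// mulr_ge0// ltW.
  rewrite exprMn -[leRHS]mulrA ler_wpM2l ?sqr_ge0//.
  apply: (le_trans (sqr_error_le p0 nep Ce0 A0 x0' hE)).
  by rewrite ler_wpM2r ?addr_ge0// /Cf lerDl.
have Ig : (\int[P]_w gw w <= (C1 * h ^+ 2)%:E)%E.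
  rewrite ge0_integralZl//; last 3 first.
  - exact: emeasurable_funD.
  - by move=> w _; exact: adde_ge0.
  - by rewrite lee_fin ltW.
  have i1 : (\int[P]_w (1 : \bar R) = 1)%E.
    by rewrite (integral_cst P measurableT 1%E) mul1e; exact: probability_setT.
  rewrite ge0_integralD// i1.
  have -> : C1 * h ^+ 2 = h ^+ 2 * Cf * (1 + CS) by rewrite /C1; ring.
  rewrite [leRHS]EFinM; apply: lee_pmul => //.
  - by rewrite lee_fin ltW.
  - by rewrite adde_ge0// integral_ge0.
  rewrite EFinD leeD2l//; exact: (integral_noise_sum hT hH hB p0 ph N0 h0 t0 tn tS th).
have CS0 : 0 <= CS.
  rewrite -lee_fin; apply: (le_trans _ (integral_noise_sum hT hH hB p0 ph N0 h0 t0 tn tS th)).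
  by apply: integral_ge0 => w _; exact: noise_sum_ge0.
have C10 : 0 <= C1 by rewrite mulr_ge0 ?(ltW Cf0)// addr_ge0.
have h20 : 0 <= h ^+ 2 by exact: sqr_ge0.
split.
  apply: (@le_trans _ _ (\int[P]_w gw w)%E).
    apply: le_integral_ae_dominated => // [w|].
      apply: (@le_trans _ _ (enorm (Y 0 w - X 0 w) ^+ 2)%:E).
        by rewrite lee_fin sqr_ge0.
      by apply: ereal_sup_ubound; exists 0 => //=; rewrite in_itv/= lexx ltW.
    apply: filterS key => w kw; apply: ge_ereal_sup => _ [t /= tT <-]; exact: kw.
  apply: (le_trans Ig); rewrite lee_fin ler_wpM2r// ler_peMr// lerDl ltW//.
have slice t : t \in `[0, T] ->
    (\int[P]_w (enorm (Y t w - X t w) ^+ 2)%:E <= (C1 * h ^+ 2)%:E)%E.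
  move=> tT; apply: le_trans Ig; apply: le_integral_ae_dominated => // [w|].
    by rewrite lee_fin sqr_ge0.
  by apply: filterS key => w; exact.
apply: (@le_trans _ _ (\int[lebesgue_measure]_(t in `[0%R, T]) (cst (C1 * h ^+ 2)%:E) t)%E).
  apply: le_integral_dominated => // [t|t].
  - by apply: integral_ge0 => w _; rewrite lee_fin sqr_ge0.
  - by rewrite lee_fin mulr_ge0.
rewrite integral_cst//= lebesgue_measure_itv/= lte_fin hT oppr0 adde0 -EFinM lee_fin.
rewrite mulrAC ler_wpM2r// ler_wpM2l// lerDr//.
Qed.
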